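(* Let $I=(0,1)$ and let $T$ be the Hardy operator $(Tf)(s)=\int_0^s f(t)\,dt$, $s\in I$. For every $p\in(1,\infty)$, the map $T:L_2(I)\to L_p(I)$ is $q$-compact for all $q\in(1,\infty]$. In particular, $T:L_2(I)\to L_2(I)$ is $q$-compact for all $q\in(1,\infty]$, but it is not nuclear.
   Context: For $1<q<\infty$, a bounded linear map $S:X\to Y$ between Banach spaces is $q$-compact if there is a sequence $\{z_n\}$ in $Y$ with $\{\|z_n\|_Y\}\in l_q$ such that the image of the closed unit ball of $X$ is contained in $\{\sum_{n=1}^\infty\alpha_nz_n:\sum_{n=1}^\infty|\alpha_n|^{q'}\le1\}$, where $1/q+1/q'=1$. For $q=\infty$ the condition is the same with $\{\|z_n\|_Y\}\in c_0$ and $\sum_{n}|\alpha_n|\le1$ (equivalently, $S$ is compact). *)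

(* Defs.v *)
From HB Require Import structures.
From mathcomp Require Import all_boot all_order all_algebra.
From mathcomp Require Import all_classical all_reals all_analysis.
From mathcomp Require Import measurable_realfun ess_sup_inf.

Set Implicit Arguments.
Unset Strict Implicit.
Unset Printing Implicit Defensive.

Import Order.TTheory GRing.Theory Num.Theory.
Import numFieldNormedType.Exports.

Local Open Scope classical_set_scope.
Local Open Scope ring_scope.

Section operator_classes.
Context {R : realType}.
Implicit Types (X Y : normedModType R) (q : \bar R) (a : R^nat).

Definition bounded_op X Y (S : {linear X -> Y}) : Prop :=
  exists M : R, forall x : X, `|S x| <= M * `|x|.

Definition opnorm X Y (S : {linear X -> Y}) : \bar R :=
  ereal_sup [set (`|S x|)%:E | x in [set x : X | `|x| <= 1]].

(* The space l_q for q real, replaced by c_0 (not l_oo) for q = +oo. *)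
Definition lq_c0 q a : Prop :=
  match q with
  | r%:E => (\sum_(n <oo) (`|a n| `^ r)%:E < +oo)%E
  | +oo%E => a @ \oo --> (0 : R)
  | -oo%E => False
  end.

(* Closed unit ball of l_q', 1/q + 1/q' = 1; hoelder_conjugate +oo = 1. *)
Definition conj_ball q a : Prop :=
  (\sum_(n <oo) (`|a n| `^ fine (hoelder_conjugate q))%:E <= 1)%E.

Definition q_compact X Y q (S : {linear X -> Y}) : Prop :=
  bounded_op S /\
  exists2 z : nat -> Y, lq_c0 q (fun n => `|z n|) &
    S @` [set x : X | `|x| <= 1] `<=`
    [set y : Y | exists2 a : R^nat, conj_ball q a &
                   series (fun n => a n *: z n) @ \oo --> y].

Definition nuclear X Y (S : {linear X -> Y}) : Prop :=
  exists (phi : nat -> {linear X -> R^o}) (y : nat -> Y),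
    [/\ forall n, bounded_op (phi n),
        (\sum_(n <oo) (opnorm (phi n) * `|y n|%:E) < +oo)%E &
        forall x : X, series (fun n => (phi n x : R) *: y n) @ \oo --> S x].

End operator_classes.

(* The type LspaceType mu p1 of a.e. classes only comes as a bare type: it is
   given here its structure of normed vector space. *)
Section Lspace_normed.
Context d (T : measurableType d) (R : realType).
Variables (mu : {measure set T -> \bar R}) (p : \bar R) (p1 : (1 <= p)%E).
Local Notation V := (LspaceType mu p1).

HB.instance Definition _ := gen_eqMixin V.
HB.instance Definition _ := gen_choiceMixin V.

Lemma Lspace_eqP (f g : V) :
  f = g :> V <-> (f : T -> R) = (g : T -> R) %[ae mu].
Proof.
split=> [->|]; first exact: ae_eq_refl.
move=> fg.
case: f g fg => f [[Pf]] [g [[Pg]]] /= fg.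
have e : f = g.
  by rewrite -[f]reprK -[g]reprK; apply/eqmodP/asboolP.
by subst g; rewrite (Prop_irrelevance Pf Pg).
Qed.

Lemma ae_eq_Lnorm (f g : T -> R) :
  measurable_fun setT f -> measurable_fun setT g ->
  f = g %[ae mu] -> ('N[mu]_p[EFin \o f] = 'N[mu]_p[EFin \o g])%E.
Proof.
move=> mf mg fg; rewrite unlock; case: p p1 => [r r1|_|//] /=.
- congr (_ `^ _)%E; apply: ae_eq_integral => //.
  + apply/measurable_EFinP.
    by apply: (@measurableT_comp _ _ _ _ _ _ (@powR R ^~ r)) => //;
      exact: measurableT_comp.
  + apply/measurable_EFinP.
    by apply: (@measurableT_comp _ _ _ _ _ _ (@powR R ^~ r)) => //;
      exact: measurableT_comp.
  + by apply: filterS fg => x /= /[apply] ->.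
- case: ifPn => // _. apply: eq_ess_sup.
  by apply: filterS fg => x /= /(_ I) ->.
Qed.

Fact LfunType_of_subproof (f : V) : (f : T -> R) \in Lfun mu p.
Proof.
apply/andP; split; rewrite inE /=.
  exact: (@measurable_funPT _ _ _ _ (repr (f : aeEqMfun _ _))).
exact: Lebesgue_finite.
Qed.

Definition Lspace_repr (f : V) : LfunType mu p1 :=
  Lfun_Sub p1 (LfunType_of_subproof f).

Lemma Lspace_reprE (f : V) : Lspace_repr f = f :> (T -> R).
Proof. by []. Qed.

Fact Lspace_mfun_subproof (f : LfunType mu p1) :
  measurable_fun setT (f : T -> measurableTypeR R).
Proof. exact: (@measurable_funPT _ _ _ _ (f : {mfun T >-> R})). Qed.

Definition Lspace_mfun (f : LfunType mu p1) : {mfun T >-> measurableTypeR R} :=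
  HB.pack (f : T -> measurableTypeR R)
    (isMeasurableFun.Build _ _ _ (measurableTypeR R) f
       (Lspace_mfun_subproof f)).

Definition Lspace_pi (f : LfunType mu p1) :
    {mfun_ mu, T >-> measurableTypeR R} :=
  (\pi_({mfun_ mu, T >-> measurableTypeR R})
     (Lspace_mfun f))%qT.

Fact Lspace_pi_ae (f : LfunType mu p1) :
  (Lspace_pi f : T -> R) = (f : T -> R) %[ae mu].
Proof. by have /eqmodP/asboolP := reprK (Lspace_pi f). Qed.

Fact Lspace_pi_finite (f : LfunType mu p1) : finite_norm mu p (Lspace_pi f).
Proof.
rewrite /finite_norm (@ae_eq_Lnorm _ f).
- exact: Lfunction_finite.
- exact: (@measurable_funPT _ _ _ _ (repr (Lspace_pi f))).
- exact: measurable_funPT.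
- exact: Lspace_pi_ae.
Qed.

HB.instance Definition _ (f : LfunType mu p1) :=
  isFinLebesgue.Build d T R mu p p1 (Lspace_pi f) (Lspace_pi_finite f).

Definition Lspace_class (f : LfunType mu p1) : V := Lspace_pi f.

Lemma Lspace_classE (f : LfunType mu p1) :
  (Lspace_class f : T -> R) = (f : T -> R) %[ae mu].
Proof. exact: Lspace_pi_ae. Qed.

Lemma Lspace_class_eq (f g : LfunType mu p1) :
  Lspace_class f = Lspace_class g <-> (f : T -> R) = (g : T -> R) %[ae mu].
Proof.
have Hf := Lspace_classE f; have Hg := Lspace_classE g.
split=> [/Lspace_eqP fg|fg].
  exact: ae_eq_trans (ae_eq_trans (ae_eq_sym Hf) fg) Hg.
apply/Lspace_eqP.
exact: ae_eq_trans (ae_eq_trans Hf fg) (ae_eq_sym Hg).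
Qed.

Lemma Lspace_reprK (f : V) : Lspace_class (Lspace_repr f) = f.
Proof. by apply/Lspace_eqP; exact: Lspace_classE. Qed.

Let add (f g : V) : V := Lspace_class (Lspace_repr f + Lspace_repr g).
Let opp (f : V) : V := Lspace_class (- Lspace_repr f).
Let scale (a : R) (f : V) : V := Lspace_class (a *: Lspace_repr f).

Let addrA : associative add.
Proof.
move=> f g h; apply/Lspace_class_eq.
apply: filterS2 (Lspace_classE (Lspace_repr f + Lspace_repr g))
  (Lspace_classE (Lspace_repr g + Lspace_repr h)) =>
  x /(_ I) /= fg /(_ I) /= gh _.
by rewrite !fctE fg gh [LHS]addrA.
Qed.

Let addrC : commutative add.
Proof. by move=> f g; rewrite /add addrC. Qed.

Let add0r : left_id (Lspace_class 0) add.
Proof.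
move=> f; rewrite -[RHS]Lspace_reprK; apply/Lspace_class_eq.
by apply: filterS (Lspace_classE 0) => x /(_ I) /= e _;
  rewrite !fctE e [LHS]add0r.
Qed.

Let addNr : left_inverse (Lspace_class 0) opp add.
Proof.
move=> f; apply/Lspace_class_eq.
apply: filterS (Lspace_classE (- Lspace_repr f)) => x /(_ I) /= e _.
by rewrite !fctE e [LHS]addNr.
Qed.

HB.instance Definition _ := GRing.isZmodule.Build V addrA addrC add0r addNr.

Let scalerA a b (f : V) : scale a (scale b f) = scale (a * b) f.
Proof.
apply/Lspace_class_eq.
apply: filterS (Lspace_classE (b *: Lspace_repr f)) => x /(_ I) /= e _.
by rewrite !fctE e [LHS]mulrA.
Qed.

Let scale1r : left_id 1 scale.
Proof. by move=> f; rewrite /scale scale1r Lspace_reprK. Qed.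

Let scalerDr : right_distributive scale +%R.
Proof.
move=> a f g; apply/Lspace_class_eq.
apply: filterS3 (Lspace_classE (Lspace_repr f + Lspace_repr g))
  (Lspace_classE (a *: Lspace_repr f)) (Lspace_classE (a *: Lspace_repr g)).
move=> x /(_ I) /= fg /(_ I) /= af /(_ I) /= ag _.
by rewrite !fctE fg af ag [LHS]mulrDr.
Qed.

Let scalerDl (f : V) : {morph scale^~ f : a b / a + b}.
Proof.
move=> a b; apply/Lspace_class_eq.
apply: filterS2 (Lspace_classE (a *: Lspace_repr f))
  (Lspace_classE (b *: Lspace_repr f)).
move=> x /(_ I) /= af /(_ I) /= bf _.
by rewrite !fctE af bf [LHS]mulrDl.
Qed.

HB.instance Definition _ := GRing.Zmodule_isLmodule.Build R V
  scalerA scale1r scalerDr scalerDl.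

Let norm (f : V) : R := fine ('N[mu]_p[EFin \o f])%E.

Let norm_class (f : LfunType mu p1) :
  norm (Lspace_class f) = fine ('N[mu]_p[EFin \o f])%E.
Proof.
congr fine; apply: ae_eq_Lnorm; [|exact: measurable_funPT|exact: Lspace_classE].
exact: (@measurable_funPT _ _ _ _ (Lspace_repr (Lspace_class f))).
Qed.

Let ler_normD (f g : V) : norm (f + g) <= norm f + norm g.
Proof. by rewrite norm_class; exact: ler_LnormD. Qed.

Let normrZ a (f : V) : norm (a *: f) = `|a| * norm f.
Proof. by rewrite norm_class LnormZ -finite_norm_fine. Qed.

Let normr0_eq0 (f : V) : norm f = 0 -> f = 0.
Proof.
move=> f0; rewrite -[f]Lspace_reprK; apply/Lspace_class_eq.
exact: fine_Lnormr_eq0.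
Qed.

HB.instance Definition _ :=
  Lmodule_isNormed.Build R V ler_normD normrZ normr0_eq0.

Lemma Lspace_normE (f : V) : `|f| = fine ('N[mu]_p[EFin \o f])%E.
Proof. by []. Qed.

Lemma Lspace_classD (f g : LfunType mu p1) :
  Lspace_class (f + g) = Lspace_class f + Lspace_class g.
Proof.
apply/esym/Lspace_class_eq.
apply: filterS2 (Lspace_classE f) (Lspace_classE g).
by move=> x /(_ I) /= ef /(_ I) /= eg _; rewrite !fctE ef eg.
Qed.

Lemma Lspace_classZ a (f : LfunType mu p1) :
  Lspace_class (a *: f) = a *: Lspace_class f.
Proof.
apply/esym/Lspace_class_eq.
by apply: filterS (Lspace_classE f) => x /(_ I) /= ef _; rewrite !fctE ef.
Qed.

Lemma Lspace_norm_class (f : LfunType mu p1) :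
  `|Lspace_class f| = fine ('N[mu]_p[EFin \o f])%E.
Proof. exact: norm_class. Qed.

End Lspace_normed.

Section unit_interval.
Variable R : realType.

(* Lebesgue measure on I = (0,1), carried by R: a class modulo lebesgueI-a.e.
   equality is a class of functions on I, values outside I being irrelevant. *)
Definition lebesgueI : {measure set (measurableTypeR R) -> \bar R} :=
  mrestr lebesgue_measure (measurable_itv `]0 : R, 1[).

Lemma lebesgueI_setT : lebesgueI setT = 1%E.
Proof.
rewrite /lebesgueI /= /mrestr setTI.
by rewrite lebesgue_measure_itv /= lte_fin ltr01 oppr0 adde0.
Qed.

Lemma gt1_lee1 (p : R) : 1 < p -> (1 <= p%:E)%E.
Proof. by move=> p1; rewrite lee_fin ltW. Qed.

Lemma lt1r2 : 1 < 2 :> R. Proof. by rewrite ltr1n. Qed.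

End unit_interval.

(* L_p(I), for p1 : 1 < p *)
Notation LI p1 := (LspaceType (lebesgueI _) (gt1_lee1 p1)).

Section hardy.
Variable R : realType.
Local Notation mu := (lebesgueI R).

(* For s in I, `]0, s[ lies in I, where lebesgueI is Lebesgue measure. *)
Definition hardy_fun (f : R -> R) (s : R) : R := \int[mu]_(t in `]0, s[) f t.

Let mitv (s : R) : measurable (`]0, s[ : set (measurableTypeR R)).
Proof. exact: measurable_itv. Qed.

Let L2_integrable (f : LI (lt1r2 R)) : mu.-integrable setT (EFin \o f).
Proof.
apply/Lfun1_integrable/Lfun_subset12; last exact: LfunType_of_subproof.
by rewrite lebesgueI_setT.
Qed.

Let L2_integrableS s (f : LI (lt1r2 R)) : mu.-integrable `]0, s[ (EFin \o f).
Proof. by apply: integrableS (L2_integrable f). Qed.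

Let hardy_fun_nd (f : R -> R) : (forall x, 0 <= f x) ->
  mu.-integrable setT (EFin \o f) -> nondecreasing_fun (hardy_fun f).
Proof.
move=> f0 intf s t st; apply: fine_le.
- by apply: integrable_fin_num => //; apply: integrableS intf.
- by apply: integrable_fin_num => //; apply: integrableS intf.
- apply: ge0_subset_integral => //.
  + by apply: measurable_funTS; case/integrableP: intf.
  + by move=> x _; rewrite lee_fin.
  + by apply: subset_itvl; rewrite bnd_simp.
Qed.

Let measurable_hardy_fun (f : LI (lt1r2 R)) : measurable_fun setT (hardy_fun f).
Proof.
have intf := L2_integrable f.
have ip : mu.-integrable setT (EFin \o f^\+%R).
  by rewrite -funerpos; exact: integrable_funepos.
have iN : mu.-integrable setT (EFin \o f^\-%R).
  by rewrite -funerneg; exact: integrable_funeneg.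
rewrite (_ : hardy_fun f = hardy_fun f^\+ \- hardy_fun f^\-).
  apply: measurable_funB; apply: nondecreasing_measurable => //.
  - exact: hardy_fun_nd.
  - exact: hardy_fun_nd.
apply/funext => s /=; rewrite /hardy_fun -RintegralB//.
- by apply: eq_Rintegral => x _; rewrite -[in LHS](funrposBneg f).
- exact: integrableS ip.
- exact: integrableS iN.
Qed.

Let hardy_fun_bounded (f : LI (lt1r2 R)) s :
  `|hardy_fun f s| <= \int[mu]_t `|f t|.
Proof.
apply: le_trans (le_normr_Rintegral _ _) _ => //.
have intf := integrable_norm (L2_integrable f).
apply: fine_le.
- by apply: integrable_fin_num => //; apply: integrableS intf.
- exact: integrable_fin_num.
- apply: ge0_subset_integral => //; by case/integrableP: intf.
Qed.

Fact hardy_fun_Lfun (p : R) (p1 : 1 < p) (f : LI (lt1r2 R)) :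
  hardy_fun f \in Lfun mu p%:E.
Proof.
have p0 : 0 <= p by rewrite (le_trans ler01)// ltW.
apply/andP; split; rewrite inE/=; first exact: measurable_hardy_fun.
rewrite /finite_norm unlock /Lnorm poweR_lty//.
set M := \int[mu]_t `|f t|.
apply: (@le_lt_trans _ _ (\int[mu]_x (M `^ p)%:E)%E).
  apply: ge0_le_integral => //.
  - by move=> x _; rewrite lee_fin powR_ge0.
  - apply/measurable_EFinP.
    apply: (@measurableT_comp _ _ _ _ _ _ (@powR R ^~ p)) => //.
    apply: (@measurableT_comp _ _ _ _ _ _ (@Num.norm R R)) => //.
    exact: measurable_hardy_fun.
  - move=> x _; rewrite lee_fin ge0_ler_powR ?nnegrE ?hardy_fun_bounded//.
    exact: le_trans (normr_ge0 _) (hardy_fun_bounded f 0).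
by rewrite integral_cst// lebesgueI_setT mule1 ltry.
Qed.

Definition hardy (p : R) (p1 : 1 < p) (f : LI (lt1r2 R)) : LI p1 :=
  Lspace_class (Lfun_Sub (gt1_lee1 p1) (hardy_fun_Lfun p1 f)).

Lemma hardyE (p : R) (p1 : 1 < p) (f : LI (lt1r2 R)) :
  (hardy p1 f : R -> R) = hardy_fun f %[ae mu].
Proof. exact: Lspace_classE. Qed.

Let hardy_linear (p : R) (p1 : 1 < p) : linear (hardy p1).
Proof.
move=> a f g; rewrite /hardy -Lspace_classZ -Lspace_classD.
apply/Lspace_class_eq/aeW => s _ /=; rewrite !fctE /hardy_fun.
transitivity (\int[mu]_(t in `]0, s[) (a * f t + g t)).
  congr fine; apply: ae_eq_integral => //.
  - by case/integrableP: (L2_integrableS s (a *: f + g)).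
  - apply/measurable_EFinP/measurable_funD; last first.
      by apply/measurable_EFinP; case/integrableP: (L2_integrableS s g).
    apply: measurable_funM => //.
    by apply/measurable_EFinP; case/integrableP: (L2_integrableS s f).
  - have := Lspace_classE (Lspace_repr (a *: f) + Lspace_repr g).
    have := Lspace_classE (a *: Lspace_repr f).
    apply: filterS2 => t /(_ I) /= af /(_ I) /= afg _.
    by rewrite afg fctE af.
have ia : mu.-integrable `]0, s[ (EFin \o (fun t => a * f t)).
  by have := integrableZl (mitv s) a (L2_integrableS s f).
by rewrite RintegralD// RintegralZl.
Qed.

HB.instance Definition _ p p1 :=
  GRing.isLinear.Build R _ _ _ (@hardy p p1) (@hardy_linear p p1).

End hardy.

(* Main.v *)
Require Import Defs.
From mathcomp Require Import all_boot all_order all_algebra.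
From mathcomp Require Import all_classical all_reals all_analysis.
From mathcomp Require Import measurable_realfun.
From mathcomp Require Import ring lra zify.
Import Order.TTheory GRing.Theory Num.Theory.
Import numFieldNormedType.Exports.
Local Open Scope classical_set_scope.
Local Open Scope ring_scope.

Set Implicit Arguments.
Unset Strict Implicit.
Unset Printing Implicit Defensive.

(** The proof expands the Hardy operator T in the Walsh functions w_n, which are
    orthonormal in L_2(I) and take only the values 1 and -1.

    Write n = m + 2^N with m < 2^N. Then w_n = w_m r_N, where the Rademacher
    function r_N is +1 and -1 on the two halves of every dyadic interval of
    length 2^-N and w_m is constant on each of these intervals; hence
    T w_n = w_m tent_N ([hardy_walshD]), where tent_N is the distance to the
    grid of mesh 2^-N. In particular |T w_n| <= 2 / (n + 1) everywhere on I
    ([hardy_walsh_le]), so the norm of T w_n in every L_p is O(1 / n).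

    Since (T f)(s) is the inner product of f with the indicator function u_s of
    [0, s[, the error of the m-th partial sum of T f = sum_n <f, w_n> T w_n at s
    is at most |f| times the distance from u_s to the span of w_0, .., w_(m-1).
    For m >= 2^N this span contains the steps at the grid points k / 2^N
    ([step_grid_proj]), so that the distance is at most 2^(-N/2). The series
    therefore converges uniformly on I, hence in every L_p
    ([hardy_walsh_series]).

    For q <= 2 one has q' >= 2, and by Bessel's inequality the sequence
    (<f, w_n>)_n lies in the unit ball of l_2, hence of l_q', while
    (|T w_n|)_n is in l_q because q > 1. For q > 2 one moves a factor
    (n + 1)^-b, with 1/2 < b < 1 - 1/q, from T w_n to the coefficients, which
    then are bounded in l_1 ([q_compact_hardy_l1]); the remaining norms are
    O((n + 1)^-(1 - b)).

    T is not nuclear because its matrix in the Walsh system is too large near a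
    shifted diagonal. With n = m + 2^j as above, <T w_n, w_m> is the integral
    of tent_j, at least 2^-j / 8 ([dot_hardy_walsh_ge]), so the sum of these
    entries over n < 2^J is at least J / 8 ([sum_dot_hardy_walsh_ge]). The same
    sum for an operator x |-> phi(x) y of rank one is at most
    sqrt(J + 1) |phi| |y| ([rank_one_trace_le]), since every w_m occurs at most
    J + 1 times. A nuclear T would give J / 8 <= nu sqrt(J + 1) for all J. *)

(** * Hilbert space structure of L_2 *)

Section inner_product.
Context d (T : measurableType d) (R : realType).
Variables (mu : {measure set T -> \bar R}) (p1 : (1 <= 2%:E :> \bar R)%E).
Local Notation H := (LspaceType mu p1).
Implicit Types (f g h : H) (a : R).

Definition dot f g : R := \int[mu]_x (f x * g x).

Lemma measurable_Lspace f : measurable_fun setT (f : T -> R).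
Proof. by have /andP[+ _] := LfunType_of_subproof f; rewrite inE. Qed.

Lemma dot_integrable f g : mu.-integrable setT (EFin \o (f \* g : T -> R)).
Proof.
apply/Lfun1_integrable.
by apply: Lfun2_mul_Lfun1; exact: LfunType_of_subproof.
Qed.

(** Inner products depend only on almost-everywhere classes: this is how they
    are computed from representatives. *)
Lemma ae_dot (u v : T -> R) f g : measurable_fun setT u -> measurable_fun setT v ->
  (f : T -> R) = u %[ae mu] -> (g : T -> R) = v %[ae mu] ->
  dot f g = \int[mu]_x (u x * v x).
Proof.
move=> mu_ mv fu gv; rewrite /dot /Rintegral; congr fine.
apply: ae_eq_integral => //.
- by apply/measurable_EFinP/measurable_funM; exact: measurable_Lspace.
- by apply/measurable_EFinP/measurable_funM.
- by apply: filterS2 fu gv => x /(_ I) /= -> /(_ I) /= ->.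
Qed.

Lemma dotC f g : dot f g = dot g f.
Proof. by apply: eq_Rintegral => x _; rewrite mulrC. Qed.

Lemma dotDl f g h : dot (f + g) h = dot f h + dot g h.
Proof.
rewrite (@ae_dot (fun x => f x + g x) h).
- rewrite /dot -RintegralD//; [|exact: dot_integrable|exact: dot_integrable].
  by apply: eq_Rintegral => x _; rewrite mulrDl.
- by apply: measurable_funD; exact: measurable_Lspace.
- exact: measurable_Lspace.
- by apply: filterS (Lspace_classE (Lspace_repr f + Lspace_repr g)) => x /(_ I).
- exact: ae_eq_refl.
Qed.

Lemma dotZl a f g : dot (a *: f) g = a * dot f g.
Proof.
rewrite (@ae_dot (fun x => a * f x) g).
- rewrite /dot -RintegralZl//; last exact: dot_integrable.
  by apply: eq_Rintegral => x _; rewrite mulrA.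
- by apply: measurable_funM => //; exact: measurable_Lspace.
- exact: measurable_Lspace.
- by apply: filterS (Lspace_classE (a *: Lspace_repr f)) => x /(_ I).
- exact: ae_eq_refl.
Qed.

Lemma dotDr f g h : dot h (f + g) = dot h f + dot h g.
Proof. by rewrite dotC dotDl dotC [dot g h]dotC. Qed.

Lemma dotZr a f g : dot f (a *: g) = a * dot f g.
Proof. by rewrite dotC dotZl dotC. Qed.

Lemma dotNr f g : dot f (- g) = - dot f g.
Proof. by rewrite -scaleN1r dotZr mulN1r. Qed.

Lemma dotBr f g h : dot h (f - g) = dot h f - dot h g.
Proof. by rewrite dotDr dotNr. Qed.

Lemma dot0r f : dot f 0 = 0.
Proof. by rewrite -(scale0r (0 : H)) dotZr mul0r. Qed.

Lemma dot_sumr (I : Type) (s : seq I) (P : pred I) (F : I -> H) f :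
  dot f (\sum_(i <- s | P i) F i) = \sum_(i <- s | P i) dot f (F i).
Proof. exact: (big_morph (dot f) (fun x y => dotDr x y f) (dot0r f)). Qed.

Lemma dot_suml (I : Type) (s : seq I) (P : pred I) (F : I -> H) f :
  dot (\sum_(i <- s | P i) F i) f = \sum_(i <- s | P i) dot (F i) f.
Proof. by rewrite dotC dot_sumr; apply: eq_bigr => i _; rewrite dotC. Qed.

Lemma dot_norm f : dot f f = `|f| ^+ 2.
Proof.
have nf : `|f|%:E = ('N[mu]_2[EFin \o f])%E.
  by rewrite Lspace_normE (finite_norm_fine (Lspace_repr f)).
apply: EFin_inj; rewrite /dot /Rintegral fineK; last first.
  by apply: integrable_fin_num => //; exact: dot_integrable.
rewrite -powR_mulrn// -poweR_EFin nf poweR_Lnorm//; apply: eq_integral => x _.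
by rewrite /= powR_mulrn// real_normK// num_real.
Qed.

Lemma dot_ge0 f : 0 <= dot f f.
Proof. by rewrite dot_norm sqr_ge0. Qed.

(** From 0 <= | |g| f - |f| g |^2. *)
Lemma dot_cauchy_schwarz f g : `|dot f g| <= `|f| * `|g|.
Proof.
suff main h k : dot h k <= `|h| * `|k|.
  rewrite ler_norml main andbT lerNl -dotNr (le_trans (main _ _))//.
  by rewrite normrN.
have [|k0] := eqVneq `|k| 0.
  by move/normr0_eq0 => ->; rewrite dot0r normr0 mulr0.
have [|h0] := eqVneq `|h| 0.
  by move/normr0_eq0 => ->; rewrite dotC dot0r normr0 mul0r.
have hk : 0 < `|h| * `|k| by rewrite mulr_gt0// lt0r normr_ge0 ?h0 ?k0.
have := dot_ge0 (`|k| *: h - `|h| *: k).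
rewrite dotBr !(dotC (_ - _)) !dotBr !dotZr !(dotC (_ *: _)) !dotZr (dotC k h).
rewrite !dot_norm => H0.
by rewrite -(ler_pM2l hk); lra.
Qed.

End inner_product.

Section orthonormal.
Context d (T : measurableType d) (R : realType).
Variables (mu : {measure set T -> \bar R}) (p1 : (1 <= 2%:E :> \bar R)%E).
Local Notation H := (LspaceType mu p1).
Variable e : nat -> H.
Hypothesis e_orth : forall n m, dot (e n) (e m) = (n == m)%:R.
Implicit Types (f g : H) (c : nat -> R).

Lemma dot_comb c N n : dot (\sum_(i < N) c i *: e i) (e n) =
  (n < N)%N%:R * c n.
Proof.
rewrite dot_suml; under eq_bigr do rewrite dotZl e_orth.
have [nN|nN] := ltnP n N.
  rewrite (bigD1 (Ordinal nN))//= eqxx mulr1 big1 ?addr0 ?mul1r// => i.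
  by rewrite -val_eqE/= => /negbTE ->; rewrite mulr0.
rewrite big1 ?mul0r// => i _.
by rewrite ltn_eqF ?mulr0// (leq_trans (ltn_ord i)).
Qed.

Lemma pythagoras c N :
  `|\sum_(i < N) c i *: e i| ^+ 2 = \sum_(i < N) c i ^+ 2.
Proof.
rewrite -dot_norm dot_sumr; apply: eq_bigr => i _.
by rewrite dotZr dot_comb ltn_ord mul1r expr2.
Qed.

Definition ortho_proj N f : H := \sum_(i < N) dot f (e i) *: e i.

Lemma norm_sub_proj N f :
  `|f - ortho_proj N f| ^+ 2 = `|f| ^+ 2 - \sum_(i < N) dot f (e i) ^+ 2.
Proof.
have dfp : dot f (ortho_proj N f) = \sum_(i < N) dot f (e i) ^+ 2.
  by rewrite dot_sumr; apply: eq_bigr => i _; rewrite dotZr expr2.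
rewrite -dot_norm dotBr !(dotC (_ - _)) !dotBr !dot_norm.
rewrite [`|ortho_proj N f| ^+ 2](pythagoras (fun i => dot f (e i))) (dotC _ f) dfp.
by rewrite subrr subr0.
Qed.

Lemma bessel N f : \sum_(i < N) dot f (e i) ^+ 2 <= `|f| ^+ 2.
Proof. by rewrite -subr_ge0 -norm_sub_proj sqr_ge0. Qed.

Lemma norm_sub_proj_le N f : `|f - ortho_proj N f| <= `|f|.
Proof.
rewrite -(@ler_sqr _ `|_| `|f|) ?nnegrE// norm_sub_proj gerBl.
by apply: sumr_ge0 => i _; rewrite sqr_ge0.
Qed.

End orthonormal.

(** * The interval I and step functions *)

Section unit_interval.
Variable R : realType.
Local Notation mu := (lebesgueI R).
Local Notation L2 := (LI (lt1r2 R)).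
Implicit Types (f g : R -> R) (a b s : R).

Lemma lebesgueI_itvco a b : 0 <= a -> a <= b -> b <= 1 ->
  mu `[a, b[%classic = (b - a)%:E.
Proof.
rewrite le_eqVlt => /predU1P[<-|a0] ab b1; rewrite /lebesgueI /= /mrestr.
- rewrite (_ : _ `&` _ = `]0, b[%classic :> set R).
    rewrite lebesgue_measure_itv/= lte_fin -EFinD.
    by case: ltP => // ?; congr EFin; lra.
  apply/seteqP; split=> x /=; rewrite !in_itv/=.
    by case=> /andP[_ ->] /andP[->].
  by move=> /andP[x0 xb]; rewrite x0 xb ltW//= (lt_le_trans xb).
- rewrite (_ : _ `&` _ = `[a, b[%classic :> set R).
    rewrite lebesgue_measure_itv/= lte_fin -EFinD.
    by case: ltP => // ?; congr EFin; lra.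
  apply/seteqP; split=> x /=; rewrite !in_itv/=; first by case.
  by move=> /andP[ax xb]; rewrite ax xb (lt_le_trans a0)//= (lt_le_trans xb).
Qed.

(** The complement of I is a null set. *)
Lemma lebesgueI_ae (P : R -> Prop) :
  (forall x, 0 < x < 1 -> P x) -> {ae mu, forall x, P x}.
Proof.
move=> PI; exists (~` `]0, 1[%classic); split.
- by apply: measurableC; exact: measurable_itv.
- by rewrite /lebesgueI /= /mrestr setICl measure0.
- by move=> x /= nPx; rewrite in_itv/= => xI; exact/nPx/PI.
Qed.

Definition bounded_measurable f :=
  measurable_fun setT f /\ exists M : R, forall x, `|f x| <= M.

Lemma bounded_measurable_cst a : bounded_measurable (cst a).
Proof. by split => //; exists `|a|. Qed.

Lemma bounded_measurableM f g :
  bounded_measurable f -> bounded_measurable g -> bounded_measurable (f \* g).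
Proof.
move=> [mf [M fM]] [mg [N gN]]; split; first exact: measurable_funM.
by exists (M * N) => x; rewrite normrM ler_pM.
Qed.

Lemma bounded_measurableB f g :
  bounded_measurable f -> bounded_measurable g -> bounded_measurable (f \- g).
Proof.
move=> [mf [M fM]] [mg [N gN]]; split; first exact: measurable_funB.
by exists (M + N) => x; rewrite (le_trans (ler_normB _ _))// lerD.
Qed.

Lemma bounded_measurable_indic (A : set (measurableTypeR R)) : measurable A ->
  bounded_measurable \1_A.
Proof.
move=> mA; split; first exact: measurable_indic.
by exists 1 => x; rewrite indicE; case: (x \in A); rewrite ?normr1 ?normr0.
Qed.

Lemma bounded_measurable_integrable f (A : set (measurableTypeR R)) :
  bounded_measurable f -> measurable A -> mu.-integrable A (EFin \o f).
Proof.
move=> [mf [M fM]] mA; apply: integrableS measurableT mA (@subsetT _ _) _.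
apply: measurable_bounded_integrable => //.
  by rewrite lebesgueI_setT ltry.
exists M; split; first exact: num_real.
by move=> N MN x _ /=; apply: le_trans (fM x) _; exact: ltW.
Qed.

Lemma bounded_measurable_Lfun f (p : R) : 1 < p -> bounded_measurable f ->
  f \in Lfun mu p%:E.
Proof.
move=> p1 [mf [M fM]]; apply/andP; split; rewrite inE//= /finite_norm.
rewrite unlock /Lnorm poweR_lty//.
apply: (@le_lt_trans _ _ (\int[mu]_x (M `^ p)%:E)%E).
  have p0 : 0 <= p by rewrite (le_trans ler01)// ltW.
  apply: ge0_le_integral => //.
  - by move=> x _; rewrite lee_fin powR_ge0.
  - apply/measurable_EFinP.
    apply: (@measurableT_comp _ _ _ _ _ _ (@powR R ^~ p)) => //.
    exact: measurableT_comp.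
  - move=> x _; rewrite lee_fin ge0_ler_powR ?nnegrE//.
    exact: le_trans (normr_ge0 _) (fM x).
by rewrite integral_cst// lebesgueI_setT mule1 ltry.
Qed.

Definition L2class f (bf : bounded_measurable f) : L2 :=
  Lspace_class (Lfun_Sub (gt1_lee1 (lt1r2 R))
    (bounded_measurable_Lfun (lt1r2 R) bf)).

Lemma L2classE f (bf : bounded_measurable f) :
  (L2class bf : R -> R) = f %[ae mu].
Proof. exact: Lspace_classE. Qed.

Lemma dot_L2class2 f g (bf : bounded_measurable f) (bg : bounded_measurable g) :
  dot (L2class bf) (L2class bg) = \int[mu]_x (f x * g x).
Proof. by apply: ae_dot; [case: bf|case: bg|exact: L2classE..]. Qed.

Let bounded_step s : bounded_measurable \1_`[0, s[.
Proof. by apply: bounded_measurable_indic; exact: measurable_itv. Qed.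

Definition step s : L2 := L2class (bounded_step s).

Lemma Rintegral_indic f (A : set (measurableTypeR R)) :
  \int[mu]_x (f x * \1_A x) = \int[mu]_(x in A) f x.
Proof.
rewrite [RHS]Rintegral_mkcond; apply: eq_Rintegral => x _.
by rewrite patchE indicE; case: (x \in A); rewrite ?mulr1 ?mulr0.
Qed.


(** This turns pointwise questions on T f into geometry of the step functions
    in L_2. *)
Lemma hardy_fun_dot (f : L2) s : hardy_fun f s = dot f (step s).
Proof.
rewrite (@ae_dot _ _ _ _ _ f (\1_`]0, s[)).
- by rewrite Rintegral_indic.
- exact: measurable_Lspace.
- by apply: measurable_indic; exact: measurable_itv.
- exact: ae_eq_refl.
- apply: ae_eq_trans (L2classE (bounded_step s)) _.
  apply: lebesgueI_ae => x /andP[x0 _] _.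
  by rewrite !indicE !mem_setE !in_itv/= x0 ltW.
Qed.

Lemma dot_step a b : 0 <= a -> a <= b -> b <= 1 -> dot (step a) (step b) = a.
Proof.
move=> a0 ab b1; rewrite dot_L2class2.
transitivity (\int[mu]_t (cst 1 t * \1_`[0, a[ t)); last first.
  rewrite Rintegral_indic Rintegral_cst; last exact: measurable_itv.
  by rewrite lebesgueI_itvco ?(le_trans ab)//= mul1r subr0.
apply: eq_Rintegral => t _; rewrite !indicE !mem_setE !in_itv/= mul1r.
case: (0 <= t) => //=; rewrite ?mul0r//.
by have [ta|_] := ltP t a; rewrite ?mul0r// (lt_le_trans ta)// mulr1.
Qed.

Lemma norm_stepB a b : 0 <= a -> a <= b -> b <= 1 ->
  `|step b - step a| ^+ 2 = b - a.
Proof.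
move=> a0 ab b1.
rewrite -dot_norm dotBr !(dotC (_ - _)) !dotBr (dotC (step b) (step a)).
by rewrite !dot_step; lra.
Qed.

End unit_interval.

(** * Rademacher and Walsh functions *)

Section walsh.
Variable R : realType.
Implicit Types (s t : R) (N n m : nat).

(** The index k of the dyadic interval [k / 2^N, (k + 1) / 2^N[ containing t.
    *)
Definition cell N t : int := Num.floor (2 ^+ N * t).

Lemma cell_itv N t : (cell N t)%:~R <= 2 ^+ N * t < (cell N t)%:~R + 1.
Proof. by rewrite -[1]/(1%:~R) -intrD; exact: floor_itv. Qed.

Lemma cell_def N t (k : int) : k%:~R <= 2 ^+ N * t < k%:~R + 1 -> cell N t = k.
Proof. by move=> h; apply: floor_def; rewrite intrD. Qed.

Lemma cellS N t :
  cell N.+1 t = if 2 ^+ N * t < (cell N t)%:~R + 2^-1 then 2 * cell N t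
                else 2 * cell N t + 1.
Proof.
have /andP[h1 h2] := cell_itv N t.
have i2 : (2 : int)%:~R = 2 :> R by [].
case: ltP => h; apply: cell_def; rewrite exprS -mulrA ?intrD intrM i2 ?mulr1z.
all: lra.
Qed.

Lemma cell0 t : 0 <= t < 1 -> cell 0 t = 0.
Proof. by move=> h; apply: cell_def; rewrite expr0 mul1r mulr0z add0r. Qed.

Lemma eq_cell N n s t : (n <= N)%N -> cell N s = cell N t -> cell n s = cell n t.
Proof.
move=> /subnK <-; elim: (N - n)%N => [//|k IH]; rewrite addSn => e.
by apply: IH; move: e; rewrite !cellS; case: ltP => _; case: ltP => _; lia.
Qed.

(** An affine formula in the monotone functions cell N and cell N.+1, whence
    measurability; the value is 1 on the left half and -1 on the right half of
    each dyadic interval of level N, see rademacherE. *)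
Definition rademacher N t : R :=
  1 + 4 * (cell N t)%:~R - 2 * (cell N.+1 t)%:~R.

Lemma rademacherE N t : rademacher N t =
  if 2 ^+ N * t < (cell N t)%:~R + 2^-1 then 1 else -1.
Proof.
have i2 : (2 : int)%:~R = 2 :> R by [].
by rewrite /rademacher cellS; case: ltP => _; rewrite ?intrD intrM i2 ?mulr1z; lra.
Qed.

Lemma rademacher_sqr N t : rademacher N t * rademacher N t = 1.
Proof. by rewrite rademacherE; case: ltP => _; lra. Qed.

Lemma rademacherM N s t : cell N s = cell N t ->
  rademacher N s * rademacher N t =
  if cell N.+1 s == cell N.+1 t then 1 else -1.
Proof.
move=> st; rewrite !rademacherE !cellS st.
case: ltP => _; case: ltP => _; rewrite ?eqxx; try lra.
- by case: eqP => [|_]; [lia|lra].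
- by case: eqP => [|_]; [lia|lra].
Qed.

(** Constancy on the dyadic intervals of level N. *)
Definition dyadic N (f : R -> R) := forall s t, cell N s = cell N t -> f s = f t.

Lemma dyadic_rademacher N n : (n < N)%N -> dyadic N (rademacher n).
Proof.
move=> nN s t st; rewrite /rademacher (eq_cell (ltnW nN) st).
by rewrite (eq_cell nN st).
Qed.

(** The product of the rademacher j over the binary digits 1 of n (Paley
    ordering). The bound j < n is harmless, as n < 2 ^ n. *)
Definition walsh n t : R :=
  \prod_(0 <= j < n) if odd (n %/ 2 ^ j) then rademacher j t else 1.

Lemma walsh_trunc N n t : (n < 2 ^ N)%N -> walsh n t =
  \prod_(0 <= j < N) if odd (n %/ 2 ^ j) then rademacher j t else 1.
Proof.
have trunc M K : (n < 2 ^ M)%N -> (M <= K)%N ->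
    \prod_(0 <= j < K) (if odd (n %/ 2 ^ j) then rademacher j t else 1) =
    \prod_(0 <= j < M) if odd (n %/ 2 ^ j) then rademacher j t else 1.
  move=> nM MK; rewrite (big_cat_nat (leq0n M) MK)/=.
  rewrite [X in _ * X = _]big_nat [X in _ * X = _]big1 ?mulr1// => j /andP[Mj _].
  by rewrite divn_small// (leq_trans nM)// leq_exp2l.
move=> nN; have [Nn|/ltnW nN'] := leqP N n; first exact: trunc.
by apply/esym/trunc => //; exact: ltn_expl.
Qed.

Lemma walshD N m t : (m < 2 ^ N)%N ->
  walsh (m + 2 ^ N) t = walsh m t * rademacher N t.
Proof.
move=> mN; have ltN : (m + 2 ^ N < 2 ^ N.+1)%N.
  by rewrite expnS mul2n -addnn ltn_add2r.
rewrite (walsh_trunc _ ltN) big_nat_recr//= divnDr// divnn expn_gt0/=.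
rewrite divn_small//; congr (_ * _); rewrite (walsh_trunc _ mN).
apply: eq_big_nat => j /andP[_ jN].
rewrite divnDr ?dvdn_exp2l ?(ltnW jN)// oddD -expnB// ?(ltnW jN)//.
by rewrite oddX/= subn_eq0 leqNgt jN addbF.
Qed.

Lemma walsh0 t : walsh 0 t = 1.
Proof. by rewrite /walsh big_geq. Qed.

(** Induction on the binary expansion, adding a top digit. *)
Lemma walsh_ind (P : nat -> Prop) : P 0%N ->
  (forall N m, (m < 2 ^ N)%N -> P m -> P (m + 2 ^ N)%N) -> forall n, P n.
Proof.
move=> P0 PD n; have [N] : exists N, (n < 2 ^ N)%N by exists n; exact: ltn_expl.
elim: N n => [n|N IH n]; first by rewrite ltnS leqn0 => /eqP ->.
have [/IH//|Nn] := ltnP n (2 ^ N).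
rewrite expnS mul2n -addnn -ltn_subLR// => h.
by rewrite -(subnK Nn); apply: PD => //; exact: IH.
Qed.

Lemma walsh_sqr n t : walsh n t * walsh n t = 1.
Proof.
elim/walsh_ind: n => [|N m mN IH]; first by rewrite walsh0 mulr1.
by rewrite walshD// mulrACA IH rademacher_sqr mulr1.
Qed.

Lemma norm_walsh n t : `|walsh n t| = 1.
Proof.
have : `|walsh n t| ^+ 2 = 1 by rewrite -normrX expr2 walsh_sqr normr1.
by move=> /eqP; rewrite sqrp_eq1// => /eqP.
Qed.

Lemma dyadic_walsh N n : (n < 2 ^ N)%N -> dyadic N (walsh n).
Proof.
move=> nN s t st; rewrite !(walsh_trunc _ nN); apply: eq_big_nat => j /andP[_ jN].
by rewrite (dyadic_rademacher jN st).
Qed.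

Lemma sum_pow2S (V : nmodType) N (F : nat -> V) :
  \sum_(i < 2 ^ N.+1) F i = \sum_(i < 2 ^ N) F i + \sum_(i < 2 ^ N) F (i + 2 ^ N)%N.
Proof.
have -> : (2 ^ N.+1 = 2 ^ N + 2 ^ N)%N by rewrite expnS mul2n addnn.
rewrite big_split_ord/=; congr (_ + _).
by apply: eq_bigr => i _; rewrite addnC.
Qed.

(** By induction, the sum is the product over j < N of 1 + rademacher j s *
    rademacher j t, and a factor vanishes as soon as the dyadic intervals of s
    and t differ. *)
Lemma walsh_kernel N s t : cell 0 s = cell 0 t ->
  \sum_(n < 2 ^ N) walsh n s * walsh n t = 2 ^+ N * (cell N s == cell N t)%:R.
Proof.
move=> st0; elim: N => [|N IH].
  by rewrite expn0 big_ord1 !walsh0 st0 eqxx expr0.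
rewrite (sum_pow2S N (fun n => walsh n s * walsh n t)) IH.
under eq_bigr => i _ do rewrite !walshD// mulrACA.
rewrite -mulr_suml IH; case: (cell N s =P cell N t) => [st|st].
  by rewrite rademacherM// exprS; case: ifP => _ /=; rewrite ?mulr1n ?mulr0n; ring.
rewrite (_ : (_ == _) = false) ?mulr0 ?mul0r ?addr0//.
by apply/negbTE/eqP => st'; apply/st/(eq_cell (leqnSn N) st').
Qed.

Lemma measurable_rademacher N : measurable_fun setT (rademacher N).
Proof.
have mcell n : measurable_fun setT (fun t => (cell n t)%:~R : R).
  apply: nondecreasing_measurable => // s t st.
  by rewrite ler_int; apply: le_floor; rewrite ler_pM2l ?exprn_gt0.
by apply: measurable_funB; [apply: measurable_funD => //|];
  exact: measurable_funM.
Qed.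

Lemma bounded_measurable_rademacher N : bounded_measurable (rademacher N).
Proof.
split; first exact: measurable_rademacher.
by exists 1 => t; rewrite rademacherE; case: ifP; rewrite ?normrN normr1.
Qed.

Lemma bounded_measurable_walsh n : bounded_measurable (walsh n).
Proof.
split; last by exists 1 => t; rewrite norm_walsh.
elim/walsh_ind: n => [|N m mN IH].
  by rewrite (_ : walsh 0 = cst 1)//; apply/funext => t; rewrite walsh0.
rewrite (_ : walsh _ = walsh m \* rademacher N).
  by apply: measurable_funM => //; exact: measurable_rademacher.
by apply/funext => t; rewrite walshD.
Qed.

End walsh.

(** * Primitives of Rademacher-modulated dyadic functions *)

Section walsh_integrals.
Variable R : realType.
Local Notation mu := (lebesgueI R).
Implicit Types (f g : R -> R) (a b c s t v : R) (N n m k : nat).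

Lemma Rintegral_const_itv f v a b : 0 <= a -> a <= b -> b <= 1 ->
  (forall x, a <= x < b -> f x = v) ->
  \int[mu]_(x in `[a, b[) f x = v * (b - a).
Proof.
move=> a0 ab b1 fv; rewrite (@eq_Rintegral _ _ _ _ _ (cst v)); last first.
  by move=> x; rewrite mem_setE in_itv => /fv.
by rewrite Rintegral_cst ?lebesgueI_itvco//; exact: measurable_itv.
Qed.

Lemma Rintegral_split_itv f a b c : bounded_measurable f -> a <= c -> c <= b ->
  \int[mu]_(x in `[a, b[) f x =
  \int[mu]_(x in `[a, c[) f x + \int[mu]_(x in `[c, b[) f x.
Proof.
move=> bf ac cb; rewrite -Rintegral_setU.
- by rewrite -itv_bndbnd_setU.
- exact: measurable_itv.
- exact: measurable_itv.
- apply: bounded_measurable_integrable => //.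
  by apply: measurableU; exact: measurable_itv.
- apply/disj_setPS => x [/=]; rewrite !in_itv/= => /andP[_ xc] /andP[cx _].
  by move: cx; rewrite leNgt xc.
Qed.

Lemma cell_grid N k : cell N (k%:R / 2 ^+ N : R) = k%:Z.
Proof.
by apply: cell_def; rewrite mulrC divfK ?expf_neq0//; apply/andP; split; lra.
Qed.

Lemma grid_itv N k t : k%:R / 2 ^+ N <= t < k.+1%:R / 2 ^+ N -> cell N t = k%:Z.
Proof.
move=> /andP[kt tk]; apply: cell_def.
move: kt tk; rewrite ler_pdivrMr ?exprn_gt0// ltr_pdivlMr ?exprn_gt0//.
by rewrite -[k.+1%:R]natr1 !(mulrC t) => -> ->.
Qed.

Lemma gridS N k : k.+1%:R / 2 ^+ N = k%:R / 2 ^+ N + (2 ^+ N)^-1 :> R.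
Proof. by rewrite -[k.+1%:R]natr1 mulrDl mul1r. Qed.

Lemma grid_ge0 N k : 0 <= k%:R / 2 ^+ N :> R.
Proof. by rewrite divr_ge0// exprn_ge0. Qed.

Lemma grid_le1 N k : (k <= 2 ^ N)%N -> k%:R / 2 ^+ N <= 1 :> R.
Proof.
by move=> kN; rewrite ler_pdivrMr ?exprn_gt0// mul1r -natrX ler_nat.
Qed.

Lemma dyadic_Rintegral N f k : bounded_measurable f -> dyadic N f ->
  (k <= 2 ^ N)%N ->
  \int[mu]_(x in `[0, k%:R / 2 ^+ N[) f x =
  (2 ^+ N)^-1 * \sum_(i < k) f (i%:R / 2 ^+ N).
Proof.
move=> bf df; elim: k => [|k IH] kN.
  by rewrite mul0r set_itvco0 Rintegral_set0 big_ord0 mulr0.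
have lek : k%:R / 2 ^+ N <= k.+1%:R / 2 ^+ N :> R.
  by rewrite ler_pM2r ?invr_gt0 ?exprn_gt0// ler_nat.
rewrite (Rintegral_split_itv bf (grid_ge0 N k) lek) IH ?(ltnW kN)//.
rewrite big_ord_recr/= mulrDr; congr (_ + _).
rewrite (@Rintegral_const_itv _ (f (k%:R / 2 ^+ N))) ?grid_ge0 ?grid_le1//.
  by rewrite gridS addrAC subrr add0r mulrC.
by move=> x /grid_itv cx; apply: df; rewrite cx cell_grid.
Qed.

(** The distance from s to the grid of mesh 1 / 2^N. *)
Definition tent N s : R :=
  Num.min (s - (cell N s)%:~R / 2 ^+ N) (((cell N s)%:~R + 1) / 2 ^+ N - s).

(** On one dyadic interval f is a constant and the Rademacher function
    integrates to a tent. *)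
Lemma rademacher_segment N f k s : bounded_measurable f -> dyadic N f ->
  (k < 2 ^ N)%N -> k%:R / 2 ^+ N <= s <= k.+1%:R / 2 ^+ N ->
  \int[mu]_(x in `[k%:R / 2 ^+ N, s[) (f x * rademacher N x) =
  f (k%:R / 2 ^+ N) * Num.min (s - k%:R / 2 ^+ N) (k.+1%:R / 2 ^+ N - s).
Proof.
move=> bf df kN.
have := grid_ge0 N k; have := grid_le1 kN.
have fk (x : R) : k%:R / 2 ^+ N <= x < k.+1%:R / 2 ^+ N -> f x = f (k%:R / 2 ^+ N).
  by move=> /grid_itv cx; apply: df; rewrite cx cell_grid.
have rk (x : R) : k%:R / 2 ^+ N <= x < k.+1%:R / 2 ^+ N ->
    rademacher N x = if x < k%:R / 2 ^+ N + 2^-1 * (2 ^+ N)^-1 then 1 else -1.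
  move=> /grid_itv cx; rewrite rademacherE cx -mulrDl.
  by rewrite ltr_pdivlMr ?exprn_gt0// mulrC.
have bfr : bounded_measurable (fun x => f x * rademacher N x).
  exact: bounded_measurableM bf (bounded_measurable_rademacher R N).
have h0 : 0 < (2 ^+ N)^-1 :> R by rewrite invr_gt0 exprn_gt0.
move: h0 fk rk; rewrite gridS.
move: (k%:R / 2 ^+ N : R) => a; move: ((2 ^+ N)^-1 : R) => h h0 fk rk b1 a0 /andP[as_ sb].
have [sc|cs] := leP s (a + 2^-1 * h).
  rewrite (@Rintegral_const_itv _ (f a)) => //; [|lra|].
    by rewrite min_l//; lra.
  move=> x /andP[ax xs]; rewrite fk ?rk ?ax ?(lt_le_trans xs)//.
  by rewrite mulr1.
rewrite (@Rintegral_split_itv _ _ _ (a + 2^-1 * h))//; [|lra|exact: ltW].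
rewrite (@Rintegral_const_itv _ (f a)); [|lra|lra|lra|]; last first.
  move=> x /andP[ax xc]; rewrite fk ?rk ?ax ?xc ?mulr1//; lra.
rewrite (@Rintegral_const_itv _ (- f a)); [|lra|lra|lra|]; last first.
  move=> x /andP[cx xs]; rewrite fk ?rk; [|lra|lra].
  by rewrite ltNge cx/= mulrN1.
by rewrite min_r; [field|lra].
Qed.

(** Over each complete dyadic interval the two halves cancel. *)
Lemma rademacher_grid N f k : bounded_measurable f -> dyadic N f ->
  (k <= 2 ^ N)%N ->
  \int[mu]_(x in `[0, k%:R / 2 ^+ N[) (f x * rademacher N x) = 0.
Proof.
move=> bf df; elim: k => [|k IH] kN.
  by rewrite mul0r set_itvco0 Rintegral_set0.
have lek : k%:R / 2 ^+ N <= k.+1%:R / 2 ^+ N :> R.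
  by rewrite ler_pM2r ?invr_gt0 ?exprn_gt0// ler_nat.
have bfr := bounded_measurableM bf (bounded_measurable_rademacher R N).
rewrite (Rintegral_split_itv bfr (grid_ge0 N k) lek) IH ?(ltnW kN)// add0r.
rewrite rademacher_segment//; last by rewrite lek lexx.
by rewrite subrr min_r ?mulr0// subr_ge0.
Qed.

Lemma rademacher_primitive N f s : bounded_measurable f -> dyadic N f ->
  0 <= s < 1 ->
  \int[mu]_(x in `[0, s[) (f x * rademacher N x) = f s * tent N s.
Proof.
move=> bf df /andP[s0 s1].
have [k ck] : exists k : nat, cell N s = k%:Z.
  exists `|cell N s|%N; rewrite gez0_abs// floor_ge0.
  by rewrite mulr_ge0// exprn_ge0.
have := cell_itv N s; rewrite ck.
have -> : (k%:Z)%:~R = k%:R :> R by [].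
rewrite natr1 mulrC -ler_pdivrMr ?exprn_gt0// -ltr_pdivlMr ?exprn_gt0//.
move=> /andP[ks sk].
have kN : (k < 2 ^ N)%N.
  rewrite -(ltr_nat R) natrX -[ltRHS]mul1r -ltr_pdivrMr ?exprn_gt0//.
  exact: le_lt_trans s1.
have bfr := bounded_measurableM bf (bounded_measurable_rademacher R N).
rewrite (Rintegral_split_itv bfr (grid_ge0 N k) ks).
(* Only the incomplete interval starting at k / 2^N contributes. *)
rewrite rademacher_grid ?(ltnW kN)// add0r rademacher_segment ?ks ?(ltW sk)//.
rewrite (df s (k%:R / 2 ^+ N)) ?ck ?cell_grid//.
by rewrite /tent ck -[_%:~R]/(k%:R) natr1.
Qed.

End walsh_integrals.

(** * The Walsh system in L_2(I) *)

Section walsh_basis.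
Variable R : realType.
Local Notation mu := (lebesgueI R).
Local Notation L2 := (LI (lt1r2 R)).
Implicit Types (f : L2) (s t : R) (N n m k : nat).

Definition walshL2 n : L2 := L2class (bounded_measurable_walsh R n).

Lemma hardy_walsh n s :
  hardy_fun (walshL2 n) s = \int[mu]_(x in `[0, s[) walsh n x.
Proof. by rewrite hardy_fun_dot dot_L2class2 Rintegral_indic. Qed.

Lemma RintegralI_itv (g : R -> R) : measurable_fun setT g ->
  \int[mu]_x g x = \int[mu]_(x in `[0, 1[) g x.
Proof.
move=> mg; rewrite -[RHS]Rintegral_indic /Rintegral; congr fine.
have m01 : measurable_fun setT (\1_`[0, 1[ : R -> R).
  by apply: measurable_indic; exact: measurable_itv.
apply: ae_eq_integral => //.
- exact/measurable_EFinP.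
- exact/measurable_EFinP/measurable_funM.
- apply: lebesgueI_ae => x /andP[x0 x1] _.
  by rewrite indicE mem_setE in_itv/= (ltW x0) x1 mulr1.
Qed.

(** The product of the Walsh functions of level N is constant on the dyadic
    intervals, on each of which rademacher N has mean 0. *)
Lemma walsh_rademacher_orth N n m : (n < 2 ^ N)%N -> (m < 2 ^ N)%N ->
  \int[mu]_x (walsh n x * walsh m x * rademacher N x) = 0.
Proof.
move=> nN mN.
have bw := bounded_measurableM (bounded_measurable_walsh R n)
  (bounded_measurable_walsh R m).
rewrite RintegralI_itv; last first.
  by have [] := bounded_measurableM bw (bounded_measurable_rademacher R N).
have := @rademacher_grid R N _ (2 ^ N) bw _ (leqnn _).
rewrite natrX divff ?expf_neq0//; apply => s t st.
by rewrite /= (dyadic_walsh nN st) (dyadic_walsh mN st).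
Qed.

Lemma walshL2_orth n m : dot (walshL2 n) (walshL2 m) = (n == m)%:R.
Proof.
rewrite dot_L2class2.
(* Induction on a common level N: if both indices have the top digit, it
   squares away; if only one has it, the product has mean 0. *)
have [N] : exists N, (n < 2 ^ N)%N && (m < 2 ^ N)%N.
  exists (n + m)%N; rewrite !(leq_ltn_trans _ (ltn_expl _ (ltnSn 1)))//.
  - exact: leq_addl.
  - exact: leq_addr.
elim: N n m => [|N IH] n m.
  rewrite expn0 !ltnS !leqn0 => /andP[/eqP -> /eqP ->]; rewrite eqxx.
  under eq_Rintegral do rewrite !walsh0 mulr1.
  by rewrite Rintegral_cst// lebesgueI_setT mulr1.
have top i : (i < 2 ^ N.+1)%N -> (2 ^ N <= i)%N ->
    exists2 j, (j < 2 ^ N)%N & i = (j + 2 ^ N)%N.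
  rewrite expnS mul2n -addnn => iN Ni; exists (i - 2 ^ N)%N; last by rewrite subnK.
  by rewrite ltn_subLR.
move=> /andP[nS mS].
have [nN|/(top _ nS)[n' nN ->]] := ltnP n (2 ^ N);
  have [mN|/(top _ mS)[m' mN ->]] := ltnP m (2 ^ N).
- by apply: IH; rewrite nN mN.
- rewrite ltn_eqF ?(leq_trans nN) ?leq_addl//.
  under eq_Rintegral do rewrite walshD// mulrA.
  exact: walsh_rademacher_orth.
- rewrite gtn_eqF ?(leq_trans mN) ?leq_addl//.
  under eq_Rintegral do rewrite walshD// mulrAC.
  exact: walsh_rademacher_orth.
- rewrite eqn_add2r -IH ?nN ?mN//; apply: eq_Rintegral => x _.
  by rewrite !walshD// mulrACA rademacher_sqr mulr1.
Qed.

Lemma norm_walshL2 n : `|walshL2 n| = 1.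
Proof.
have : `|walshL2 n| ^+ 2 = 1 by rewrite -dot_norm walshL2_orth eqxx.
by move=> /eqP; rewrite sqrp_eq1// => /eqP.
Qed.

Lemma norm_step s : 0 <= s <= 1 -> `|step s| ^+ 2 = s.
Proof.
by move=> /andP[s0 s1]; rewrite -dot_norm dot_step.
Qed.

Lemma hardy_walshD N m s : (m < 2 ^ N)%N -> 0 <= s < 1 ->
  hardy_fun (walshL2 (m + 2 ^ N)) s = walsh m s * tent N s.
Proof.
move=> mN s01; rewrite hardy_walsh.
under eq_Rintegral do rewrite walshD//.
apply: rademacher_primitive => //; last exact: dyadic_walsh.
exact: bounded_measurable_walsh.
Qed.

Lemma tent_itv N s : 0 <= tent N s <= (2 ^+ N)^-1.
Proof.
have h0 : 0 < (2 ^+ N)^-1 :> R by rewrite invr_gt0 exprn_gt0.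
have /andP[] := cell_itv N s.
rewrite mulrC -ler_pdivrMr ?exprn_gt0// -ltr_pdivlMr ?exprn_gt0// /tent.
rewrite mulrDl mul1r; move: h0; move: (_%:~R / _) => a; move: (_^-1) => h h0 as_ sa.
by rewrite le_min ge_min; apply/andP; split; [apply/andP; split|apply/orP; left];
  lra.
Qed.

Lemma hardy_walsh_le n s : 0 < s < 1 ->
  `|hardy_fun (walshL2 n) s| <= 2 * n.+1%:R^-1.
Proof.
move=> /andP[s0 s1]; elim/walsh_ind: n => [|N m mN _].
  rewrite hardy_fun_dot (le_trans (dot_cauchy_schwarz _ _))//.
  rewrite norm_walshL2 mul1r invr1 mulr1 (@le_trans _ _ 1) ?ler1n//.
  by rewrite -(@expr_le1 _ 2)// norm_step ?(ltW s0) (ltW s1).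
rewrite hardy_walshD ?(ltW s0)// normrM norm_walsh mul1r.
have /andP[t0 tN] := tent_itv N s; rewrite ger0_norm// (le_trans tN)//.
rewrite -[2 * _]invrK lef_pV2 ?posrE ?exprn_gt0//.
  rewrite invfM invrK mulrC ler_pdivrMr// -natrX -natrM ler_nat.
  by rewrite mulnC mul2n -addnn -addSn leq_add2r.
Qed.

Lemma dot_step_walsh s n : dot (step s) (walshL2 n) = hardy_fun (walshL2 n) s.
Proof. by rewrite dotC hardy_fun_dot. Qed.

(** Parseval's identity for the step at a grid point. The integral of walsh n
    up to k / 2^N is a sum over the k first dyadic intervals; squaring and
    summing over n, the kernel identity keeps only the diagonal terms. *)
Lemma sum_hardy_walsh_grid N k : (k <= 2 ^ N)%N ->
  \sum_(n < 2 ^ N) hardy_fun (walshL2 n) (k%:R / 2 ^+ N) ^+ 2 = k%:R / 2 ^+ N.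
Proof.
move=> kN.
under eq_bigr => n _.
  rewrite hardy_walsh (dyadic_Rintegral (bounded_measurable_walsh R n)
    (dyadic_walsh (ltn_ord n)) kN) exprMn [X in _ * X]expr2 mulr_suml.
  under eq_bigr do rewrite mulr_sumr.
  over.
rewrite -mulr_sumr exchange_big/=.
under eq_bigr => i _.
  rewrite exchange_big/=.
  under eq_bigr => j _.
    rewrite walsh_kernel; last first.
      rewrite !cell0 ?grid_ge0//= ltr_pdivrMr ?exprn_gt0// mul1r -natrX ltr_nat.
        exact: leq_trans (ltn_ord _) kN.
      exact: leq_trans (ltn_ord _) kN.
    rewrite !cell_grid; over.
  rewrite -mulr_sumr (bigD1 i)//= eqxx big1 ?addr0 ?mulr1; last first.
    by move=> j /negbTE; rewrite -val_eqE/= eqz_nat eq_sym => ->.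
  over.
rewrite sumr_const card_ord -mulr_natl; field.
by rewrite expf_neq0.
Qed.

Lemma ortho_projB (e : nat -> L2) m (f g : L2) :
  ortho_proj e m (f - g) = ortho_proj e m f - ortho_proj e m g.
Proof.
rewrite /ortho_proj -sumrB; apply: eq_bigr => i _.
by rewrite !(dotC _ (e i)) dotBr scalerBl.
Qed.

(** A step at a grid point of level N is in the span of the first 2 ^ N Walsh
    functions, since Bessel's inequality is an equality for it. *)
Lemma step_grid_proj N m k : (k <= 2 ^ N)%N -> (2 ^ N <= m)%N ->
  step (k%:R / 2 ^+ N) - ortho_proj walshL2 m (step (k%:R / 2 ^+ N)) = 0 :> L2.
Proof.
move=> kN Nm; apply: normr0_eq0; apply/eqP; rewrite -sqrf_eq0 eq_le sqr_ge0 andbT.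
rewrite (norm_sub_proj walshL2_orth) norm_step ?grid_ge0 ?grid_le1// subr_le0.
rewrite -[leLHS](sum_hardy_walsh_grid kN).
under [leRHS]eq_bigr do rewrite dot_step_walsh.
rewrite -!(big_mkord xpredT (fun n => hardy_fun (walshL2 n) (k%:R / 2 ^+ N) ^+ 2)).
rewrite (big_cat_nat (leq0n _) Nm)/= lerDl; apply: sumr_ge0 => i _.
exact: sqr_ge0.
Qed.

(** Compare with the step at the grid point just below s, which the projection
    fixes. *)
Lemma step_proj_le N m s : 0 < s < 1 -> (2 ^ N <= m)%N ->
  `|step s - ortho_proj walshL2 m (step s)| ^+ 2 <= (2 ^+ N)^-1.
Proof.
move=> /andP[s0 s1] Nm.
set k := `|cell N s|%N.
have ck : cell N s = k%:Z.
  by rewrite gez0_abs// floor_ge0 mulr_ge0// ?exprn_ge0// ltW.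
have := cell_itv N s; rewrite ck -[_%:~R]/(k%:R).
rewrite mulrC -ler_pdivrMr ?exprn_gt0// -ltr_pdivlMr ?exprn_gt0// mulrDl mul1r.
move=> /andP[ks sk].
have kN : (k <= 2 ^ N)%N.
  rewrite -(ler_nat R) natrX -[leRHS]mul1r -ler_pdivrMr ?exprn_gt0//.
  by rewrite (le_trans ks)// ltW.
have -> : step s - ortho_proj walshL2 m (step s) =
    (step s - step (k%:R / 2 ^+ N)) -
    ortho_proj walshL2 m (step s - step (k%:R / 2 ^+ N)).
  have /subr0_eq VPV := step_grid_proj kN Nm.
  by rewrite ortho_projB -VPV opprB addrA subrK.
have le_sqr (x y : R) : 0 <= x -> x <= y -> x ^+ 2 <= y ^+ 2.
  by move=> x0 xy; rewrite ler_sqr ?nnegrE// (le_trans x0).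
apply: le_trans (le_sqr _ _ (normr_ge0 _)
  (norm_sub_proj_le walshL2_orth m _)) _.
by rewrite norm_stepB ?grid_ge0 ?(ltW s1)// lerBlDl ltW.
Qed.

End walsh_basis.

(** * Sums of powers of 1 / (n + 1) *)

Section series_bounds.
Variable R : realType.
Implicit Types (u : R^nat) (s : R) (N n : nat).

Lemma nneseries_le_bound u (B : R) : (forall n, 0 <= u n) ->
  (forall N, \sum_(n < N) u n <= B) -> (\sum_(n <oo) (u n)%:E <= B%:E)%E.
Proof.
move=> u0 uB; apply: lime_le.
  by apply: is_cvg_nneseries => n _ _; rewrite lee_fin.
by apply: nearW => N; rewrite sumEFin lee_fin big_mkord.
Qed.

(** Over the dyadic block 2^J <= n < 2^(J+1) the sum is at most x^J with x =
    2^(1-s) < 1, and these bounds form a geometric series. *)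
Lemma harmonic_powR_bounded s : 1 < s ->
  exists B : R, forall N, \sum_(n < N) n.+1%:R^-1 `^ s <= B.
Proof.
move=> s1; pose x : R := 2^-1 `^ (s - 1).
have x0 : 0 <= x by exact: powR_ge0.
have x1 : 0 < 1 - x.
  have one : 1 `^ (s - 1) = 1 :> R by rewrite powR1.
  rewrite subr_gt0 /x -[ltRHS]one.
  by apply: gt0_ltr_powR; rewrite ?nnegrE ?subr_gt0 ?invf_lt1 ?ltr1n//.
pose F n : R := n.+1%:R^-1 `^ s.
have F0 n : 0 <= F n by exact: powR_ge0.
have block J : \sum_(i < 2 ^ J) F (i + 2 ^ J)%N <= x ^+ J.
  apply: (@le_trans _ _ (\sum_(i < 2 ^ J) (2 ^+ J)^-1 `^ s)).
    apply: ler_sum => i _; apply: ge0_ler_powR.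
    - by rewrite (le_trans _ (ltW s1)).
    - by rewrite nnegrE.
    - by rewrite nnegrE invr_ge0 exprn_ge0.
    - rewrite lef_pV2 ?posrE ?exprn_gt0// -natrX ler_nat.
      by rewrite leqW// leq_addl.
  rewrite sumr_const card_ord -[leLHS]mulr_natl natrX.
  rewrite -mulr_powRB1 ?invr_ge0 ?exprn_ge0 ?(lt_trans _ s1)//.
  rewrite mulrA divff ?expf_neq0// mul1r -exprVn -powR_mulrn//.
  by rewrite powRAC powR_mulrn.
have dy J : \sum_(n < 2 ^ J) F n <= 1 + (1 - x ^+ J) / (1 - x).
  elim: J => [|J IH].
    by rewrite big_ord1 /F invr1 powR1 expr0 subrr mul0r addr0.
  rewrite sum_pow2S (le_trans (lerD IH (block J)))//.
  rewrite -addrA lerD2l -[X in _ + X <= _](mulfK (lt0r_neq0 x1)).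
  by rewrite -mulrDl ler_pM2r ?invr_gt0// exprS; lra.
exists (1 + (1 - x)^-1) => N.
apply: (@le_trans _ _ (\sum_(n < 2 ^ N) F n)).
  rewrite -!(big_mkord xpredT F) (big_cat_nat (leq0n N) (ltnW (ltn_expl N _)))//=.
  by rewrite lerDl sumr_ge0.
rewrite (le_trans (dy N))// lerD2l ler_pdivrMr// mulVf ?gt_eqF//.
by rewrite gerBl exprn_ge0.
Qed.

Lemma nneseries_harmonic_powR u (C s : R) : 1 < s -> (forall n, 0 <= u n) ->
  (forall n, u n <= C * n.+1%:R^-1 `^ s) -> (\sum_(n <oo) (u n)%:E < +oo)%E.
Proof.
move=> s1 u0 uC; have [B HB] := harmonic_powR_bounded s1.
apply: (@le_lt_trans _ _ (`|C| * B)%:E); last exact: ltry.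
apply: nneseries_le_bound => // N.
apply: (@le_trans _ _ (\sum_(n < N) `|C| * n.+1%:R^-1 `^ s)).
  apply: ler_sum => n _; rewrite (le_trans (uC n))// ler_wpM2r ?powR_ge0//.
  exact: ler_norm.
by rewrite -mulr_sumr ler_wpM2l.
Qed.

End series_bounds.

(** * Walsh expansion of the Hardy operator *)

Section hardy_expansion.
Variable R : realType.
Local Notation mu := (lebesgueI R).
Local Notation L2 := (LI (lt1r2 R)).
Local Notation T p1 := (hardy p1 : {linear L2 -> LI p1}).
Implicit Types (f : L2) (s : R) (N n m k : nat).

Lemma norm_hardy_le (p : R) (p1 : 1 < p) f (C : R) : 0 <= C ->
  (forall s, 0 < s < 1 -> `|hardy_fun f s| <= C) -> `|hardy p1 f| <= C.
Proof.
move=> C0 fC; have p0 : 0 < p by rewrite (lt_trans _ p1).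
rewrite Lspace_norm_class -lee_fin finite_norm_fine unlock /Lnorm.
have int_le : (\int[mu]_x (`|hardy_fun f x| `^ p)%:E <= (C `^ p)%:E)%E.
  apply: (@le_trans _ _ (\int[mu]_x (cst (C `^ p)%:E x))%E); last first.
    by rewrite integral_cst// lebesgueI_setT mule1.
  apply: ae_ge0_le_integral => //.
  - apply/measurable_EFinP.
    apply: (@measurableT_comp _ _ _ _ _ _ (@powR R ^~ p)) => //.
    apply: (@measurableT_comp _ _ _ _ _ _ (@Num.norm R R)) => //.
    by have /andP[+ _] := hardy_fun_Lfun p1 f; rewrite inE.
  - by move=> x _; rewrite lee_fin powR_ge0.
  - apply: lebesgueI_ae => x /fC fx _; rewrite lee_fin.
    by apply: ge0_ler_powR => //; exact: ltW.
apply: (@le_trans _ _ ((C `^ p)%:E `^ p^-1)%E).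
  apply: gt0_ler_poweR => //.
  - by rewrite invr_ge0 ltW.
  - by rewrite in_itv/= leey andbT integral_ge0// => x _; rewrite lee_fin powR_ge0.
  - by rewrite in_itv/= leey andbT lee_fin powR_ge0.
by rewrite poweR_EFin -powRrM mulfV ?gt_eqF// powRr1.
Qed.

Lemma hardy_bounded (p : R) (p1 : 1 < p) : bounded_op (T p1).
Proof.
exists 1 => f; rewrite mul1r; apply: norm_hardy_le => // s /andP[s0 s1].
rewrite hardy_fun_dot (le_trans (dot_cauchy_schwarz _ _))//.
rewrite ler_piMr// -(@expr_le1 _ 2)// norm_step ?(ltW s0) ?(ltW s1)//.
Qed.

(** The partial sums of the series are T applied to the projections of f. As
    projections are self-adjoint, the error at s is the inner product of f
    with the component of step s that is orthogonal to the first m Walsh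
    functions, which step_proj_le bounds uniformly in s. *)
Lemma hardy_walsh_series (p : R) (p1 : 1 < p) f :
  series (fun n => dot f (walshL2 R n) *: hardy p1 (walshL2 R n)) @ \oo -->
  hardy p1 f.
Proof.
have part m N : (2 ^ N <= m)%N ->
    `|hardy p1 f - series (fun n => dot f (walshL2 R n) *: hardy p1 (walshL2 R n)) m|
    <= `|f| * Num.sqrt (2 ^+ N)^-1.
  move=> Nm.
  have -> : hardy p1 f -
      series (fun n => dot f (walshL2 R n) *: hardy p1 (walshL2 R n)) m =
      T p1 (f - ortho_proj (walshL2 R) m f).
    rewrite linearB /ortho_proj (linear_sum (T p1)) /series/= big_mkord.
    by congr (_ - _); apply: eq_bigr => n _; rewrite linearZ.
  apply: norm_hardy_le => [|s s01]; first by rewrite mulr_ge0// sqrtr_ge0.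
  rewrite hardy_fun_dot.
  have -> : dot (f - ortho_proj (walshL2 R) m f) (step s) =
      dot f (step s - ortho_proj (walshL2 R) m (step s)).
    rewrite dotBr (dotC (_ - _)) dotBr (dotC (step s) f); congr (_ - _).
    rewrite !dot_sumr; apply: eq_bigr => n _.
    by rewrite !dotZr mulrC.
  rewrite (le_trans (dot_cauchy_schwarz _ _))// ler_wpM2l//.
  rewrite -[leLHS]ger0_norm// -sqrtr_sqr ler_wsqrtr//.
  exact: step_proj_le.
apply/cvgrPdist_le => e e0.
have [N HN] : exists N, `|f| * Num.sqrt (2 ^+ N)^-1 <= e.
  pose x := `|f| ^+ 2 / e ^+ 2.
  have x0 : 0 <= x by rewrite divr_ge0 ?sqr_ge0.
  exists (Num.bound x); rewrite -[leRHS]ger0_norm ?(ltW e0)// -sqrtr_sqr.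
  rewrite -[`|f|]ger0_norm// -sqrtr_sqr -sqrtrM ?sqr_ge0// ler_wsqrtr//.
  rewrite ler_pdivrMr ?exprn_gt0// mulrC -ler_pdivrMr ?exprn_gt0//.
  rewrite (le_trans (ltW (archi_boundP x0)))// -natrX ler_nat ltnW//.
  exact: ltn_expl.
near=> m; apply: le_trans (part m N _) HN.
by near: m; exact: nbhs_infty_ge.
Unshelve. all: by end_near.
Qed.

End hardy_expansion.

(** * q-compactness *)

Section q_compactness.
Variable R : realType.
Local Notation L2 := (LI (lt1r2 R)).
Local Notation T p1 := (hardy p1 : {linear L2 -> LI p1}).
Implicit Types (f : L2) (p r b : R) (q : \bar R) (N n : nat).

(** The weights w are moved from the vectors to the coefficients of the Walsh
    expansion. *)
Lemma q_compact_hardy_weight p (p1 : 1 < p) q (w : nat -> R) :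
  (forall n, 0 < w n) ->
  lq_c0 q (fun n => `|(w n)^-1 *: hardy p1 (walshL2 R n)|) ->
  (forall f, `|f| <= 1 -> conj_ball q (fun n => w n * dot f (walshL2 R n))) ->
  q_compact q (T p1).
Proof.
move=> w0 zq aq; split; first exact: hardy_bounded.
exists (fun n => (w n)^-1 *: hardy p1 (walshL2 R n)) => // _ [f f1 <-].
exists (fun n => w n * dot f (walshL2 R n)); first exact: aq.
rewrite (_ : (fun n => _) = fun n => dot f (walshL2 R n) *: hardy p1 (walshL2 R n)).
  exact: hardy_walsh_series.
by apply/funext => n; rewrite scalerA mulrAC mulfV ?mul1r// gt_eqF.
Qed.

Lemma norm_hardy_walsh_le p (p1 : 1 < p) n :
  `|hardy p1 (walshL2 R n)| <= 2 * n.+1%:R^-1.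
Proof. by apply: norm_hardy_le => [|s]; [rewrite mulr_ge0|exact: hardy_walsh_le]. Qed.

Lemma norm_dot_walsh_le1 f n : `|f| <= 1 -> `|dot f (walshL2 R n)| <= 1.
Proof.
move=> f1; rewrite (le_trans (dot_cauchy_schwarz _ _))//.
by rewrite norm_walshL2 mulr1.
Qed.

Lemma powR_le_self (x s : R) : 0 <= x <= 1 -> 1 <= s -> x `^ s <= x.
Proof.
move=> /andP[]; rewrite le_eqVlt => /predU1P[<- _ s1|x0 x1].
  by rewrite powR0// gt_eqF// (lt_le_trans _ s1).
by apply: ge1r_powR; rewrite x0.
Qed.

Lemma powR_le_sqr (x s : R) : 0 <= x <= 1 -> 2 <= s -> x `^ s <= x ^+ 2.
Proof.
move=> /andP[]; rewrite le_eqVlt => /predU1P[<- _ s2|x0 x1 s2].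
  by rewrite powR0 ?expr0n// gt_eqF// (lt_le_trans _ s2).
by rewrite -powR_mulrn ?(ltW x0)// ger_powR// x0.
Qed.

Lemma fine_hoelder_conjugate r : 1 < r ->
  fine (hoelder_conjugate r%:E) = r / (r - 1).
Proof.
move=> r1; rewrite /hoelder_conjugate /= eqe gt_eqF ?(lt_trans _ r1)//.
by rewrite -EFinD inver gt_eqF ?subr_gt0.
Qed.

(** Here the conjugate exponent is at least 2, so that Bessel's inequality
    suffices. *)
Lemma q_compact_hardy_le2 p (p1 : 1 < p) r : 1 < r -> r <= 2 ->
  q_compact r%:E (T p1).
Proof.
move=> r1 r2; apply: (@q_compact_hardy_weight _ _ _ (fun=> 1)) => // [|f f1].
- apply: (@nneseries_harmonic_powR _ _ (2 `^ r) r) => // n.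
  rewrite -powRM// invr1 scale1r normr_id.
  by apply: ge0_ler_powR; rewrite ?nnegrE ?norm_hardy_walsh_le// ltW// (lt_trans _ r1).
- rewrite /conj_ball fine_hoelder_conjugate//.
  apply: nneseries_le_bound => [n|N]; first exact: powR_ge0.
  apply: le_trans (_ : `|f| ^+ 2 <= 1); last by rewrite expr_le1.
  apply: le_trans (bessel (@walshL2_orth R) N f); apply: ler_sum => n _.
  rewrite mul1r -[leRHS]real_normK ?num_real//; apply: powR_le_sqr.
    by rewrite normr_ge0 norm_dot_walsh_le1.
  by rewrite ler_pdivlMr ?subr_gt0//; lra.
Qed.

(** The weights (n + 1)^-b are square summable because b > 1/2, so the
    weighted Walsh coefficients are bounded in l_1, hence in every l_q' with
    q' >= 1. Up to a constant, the vectors have norm (n + 1)^-(1 - b). *)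
Lemma q_compact_hardy_l1 p (p1 : 1 < p) q b : (1 < q)%E -> 2^-1 < b -> b < 1 ->
  (forall C : R, 0 <= C -> forall u : R^nat,
    (forall n, 0 <= u n <= C * n.+1%:R^-1 `^ (1 - b)) -> lq_c0 q u) ->
  q_compact q (T p1).
Proof.
move=> q1 b12 b1 Hq.
have [D HD] : exists D : R, forall N, \sum_(n < N) n.+1%:R^-1 `^ (b * 2) <= D.
  by apply: harmonic_powR_bounded; lra.
have D0 : 0 <= D by have := HD 0%N; rewrite big_ord0.
(* c normalizes: by 2 x y <= x^2 + y^2 the l_1 norm of the weighted
   coefficients is at most c (D + 1) / 2. *)
have [c c0 cD] : exists2 c : R, 0 < c & c * (D + 1) = 2.
  by exists (2 / (D + 1)); rewrite ?divr_gt0 ?divfK ?gt_eqF ?ltr_wpDl.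
have h0 n : 0 < n.+1%:R^-1 :> R by rewrite invr_gt0.
pose w n := c * n.+1%:R^-1 `^ b.
have w0 n : 0 < w n by rewrite mulr_gt0// powR_gt0.
apply: (@q_compact_hardy_weight _ _ _ w) => // [|f f1].
- apply: (Hq (c^-1 * 2)) => [|n]; first by rewrite mulr_ge0// invr_ge0 ltW.
  rewrite normr_ge0/= normrZ gtr0_norm ?invr_gt0// invfM -!mulrA.
  rewrite ler_pM2l ?invr_gt0// ler_pdivrMl ?powR_gt0//.
  rewrite mulrCA -powRD; last by rewrite (gt_eqF (h0 n)) implybT.
  by rewrite [b + _]addrC subrK powRr1 ?(ltW (h0 n))// norm_hardy_walsh_le.
have l1 N : \sum_(n < N) `|w n * dot f (walshL2 R n)| <= 1.
  apply: (@le_trans _ _ (\sum_(n < N)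
      c / 2 * (n.+1%:R^-1 `^ (b * 2) + dot f (walshL2 R n) ^+ 2))).
    apply: ler_sum => n _; rewrite normrM gtr0_norm// /w -!mulrA ler_pM2l//.
    rewrite powRrM powR_mulrn ?powR_ge0// -[dot _ _ ^+ 2]real_normK ?num_real//.
    set x := _ `^ b; set y := `|_|.
    have : 0 <= (x - y) ^+ 2 by exact: sqr_ge0.
    by rewrite sqrrB; lra.
  rewrite -mulr_sumr big_split/=.
  have cD1 : c / 2 * (D + 1) = 1 by rewrite mulrAC cD divff.
  rewrite -[leRHS]cD1.
  rewrite ler_pM2l ?divr_gt0// lerD ?HD//.
  by rewrite (le_trans (bessel (@walshL2_orth R) N f))// expr_le1.
have le1 n : `|w n * dot f (walshL2 R n)| <= 1.
  rewrite (le_trans _ (l1 n.+1))// big_ord_recr/= lerDr.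
  by apply: sumr_ge0 => i _; exact: normr_ge0.
rewrite /conj_ball; apply: nneseries_le_bound => [n|N]; first exact: powR_ge0.
rewrite (le_trans _ (l1 N))//; apply: ler_sum => n _.
apply: powR_le_self; first by rewrite normr_ge0 le1.
case: q q1 {Hq} => [r r1|_|//]; last by rewrite hoelder_conjugatey.
rewrite fine_hoelder_conjugate// ler_pdivlMr ?subr_gt0//.
by rewrite mul1r gerBl.
Qed.

Lemma q_compact_hardy p (p1 : 1 < p) q : (1 < q)%E -> q_compact q (T p1).
Proof.
case: q => [r|_|//]; first rewrite lte_fin => r1.
- have [|r2] := leP r 2; first exact: q_compact_hardy_le2.
  have r0 : 0 < r by lra.
  (* The middle of the interval of admissible b, from 1/2 to 1 - 1/r. *)
  have rV : 0 < r^-1 < 2^-1 by rewrite invr_gt0 r0 ltf_pV2 ?posrE.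
  apply: (@q_compact_hardy_l1 _ _ _ (3 / 4 - r^-1 / 2)) => //; [lra|lra|].
  move=> C C0 u uC.
  apply: (@nneseries_harmonic_powR _ _ (C `^ r) ((1 - (3 / 4 - r^-1 / 2)) * r)).
  + have -> : (1 - (3 / 4 - r^-1 / 2)) * r = r / 4 + 2^-1.
      by field; rewrite gt_eqF.
    by lra.
  + by move=> n; exact: powR_ge0.
  + move=> n; have /andP[u0 un] := uC n.
    rewrite powRrM -powRM ?powR_ge0//.
    by apply: ge0_ler_powR; rewrite ?nnegrE ?mulr_ge0 ?powR_ge0 ?ger0_norm// ltW.
- apply: (@q_compact_hardy_l1 _ _ _ (3 / 4)); [exact: ltry|lra|lra|].
  move=> C C0 u uC; rewrite /lq_c0; apply/cvgrPdist_le => e e0.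
  have e4 : 0 < (e / (C + 1)) `^ 4 by rewrite powR_gt0// divr_gt0// ltr_wpDl.
  near=> n; rewrite sub0r normrN; have /andP[u0 un] := uC n.
  rewrite ger0_norm// (le_trans un)//.
  have hn : n.+1%:R^-1 <= (e / (C + 1)) `^ 4.
    near: n; apply: filterS (near_infty_natSinv_lt (PosNum e4)) => n /=.
    exact: ltW.
  have -> : 1 - 3 / 4 = 4^-1 :> R by lra.
  apply: (@le_trans _ _ (C * (e / (C + 1)))).
    apply: ler_wpM2l => //.
    apply: (@le_trans _ _ (((e / (C + 1)) `^ 4) `^ 4^-1)).
      by apply: ge0_ler_powR; rewrite ?nnegrE ?powR_ge0.
    rewrite -powRrM mulfV ?pnatr_eq0// powRr1// divr_ge0 ?ltW//; lra.
  by rewrite mulrCA ler_piMr ?(ltW e0)// ler_pdivrMr; lra.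
Unshelve. all: by end_near.
Qed.

End q_compactness.

(** * Failure of nuclearity *)

Section nuclear_trace.
Variable R : realType.

Section opnorm.
Variables (X Y : normedModType R) (S : {linear X -> Y}).
Hypothesis bS : bounded_op S.

Let opnorm_ge z : `|z| <= 1 -> (`|S z|%:E <= opnorm S)%E.
Proof. by move=> z1; apply: ereal_sup_ubound; exists z. Qed.

Lemma opnorm_ge0 : (0 <= opnorm S)%E.
Proof. by rewrite (le_trans _ (@opnorm_ge 0 _)) ?normr0 ?lee_fin. Qed.

Lemma opnorm_fin_num : opnorm S \is a fin_num.
Proof.
rewrite ge0_fin_numE ?opnorm_ge0//; case: bS => M SM.
apply: (@le_lt_trans _ _ `|M|%:E); last exact: ltry.
apply: ge_ereal_sup => _ [z /= z1 <-]; rewrite lee_fin.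
rewrite (le_trans (SM z))// (le_trans (ler_norm _))// normrM normr_id.
by rewrite ler_piMr.
Qed.

Lemma opnorm_le x : `|S x| <= fine (opnorm S) * `|x|.
Proof.
have [->|x0] := eqVneq x 0; first by rewrite linear0 !normr0 mulr0.
have nx : 0 < `|x| by rewrite normr_gt0.
have := @opnorm_ge (`|x|^-1 *: x).
rewrite linearZ !normrZ normfV normr_id mulVf ?gt_eqF//.
move=> /(_ (lexx _)); rewrite -(fineK opnorm_fin_num) lee_fin ler_pdivrMl//.
by rewrite mulrC.
Qed.

End opnorm.

Local Notation mu := (lebesgueI R).
Local Notation L2 := (LI (lt1r2 R)).
Local Notation T := (hardy (lt1r2 R) : {linear L2 -> L2}).
Local Notation W := (walshL2 R).
Implicit Types (f g : L2) (s : R) (N n m j J : nat).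

Lemma measurable_hardy_fun f : measurable_fun setT (hardy_fun f).
Proof. by have /andP[+ _] := hardy_fun_Lfun (lt1r2 R) f; rewrite inE. Qed.

Lemma dot_hardy_walsh f n : dot (T f) (W n) =
  \int[mu]_(s in `[0, 1[) (hardy_fun f s * walsh n s).
Proof.
have [mw _] := bounded_measurable_walsh R n.
have mh := measurable_hardy_fun f.
rewrite -RintegralI_itv; last exact: measurable_funM.
by apply: ae_dot => //; [exact: hardyE|exact: L2classE].
Qed.

Lemma hardy_walsh_integrable f n (A : set (measurableTypeR R)) : measurable A ->
  mu.-integrable A (EFin \o (hardy_fun f \* walsh n)).
Proof.
move=> mA; apply: integrableS measurableT mA (@subsetT _ _) _.
apply/Lfun1_integrable; apply: Lfun2_mul_Lfun1.
  exact: hardy_fun_Lfun (lt1r2 R) f.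
exact: bounded_measurable_Lfun (lt1r2 R) (bounded_measurable_walsh R n).
Qed.

(** The two Rademacher functions have opposite signs exactly on the middle
    half of each dyadic interval, where the tent is at least a quarter of its
    width. *)
Lemma tent_ge N s :
  (8 * 2 ^+ N)^-1 * (1 - rademacher N s * rademacher N.+1 s) <= tent N s.
Proof.
have h0 : 0 < (2 ^+ N)^-1 :> R by rewrite invr_gt0 exprn_gt0.
have -> : tent N s = (2 ^+ N)^-1 *
    Num.min (2 ^+ N * s - (cell N s)%:~R) ((cell N s)%:~R + 1 - 2 ^+ N * s).
  rewrite minr_pMr ?(ltW h0)// !mulrBr mulKf ?expf_neq0// /tent.
  by congr Num.min; congr (_ - _); rewrite mulrC.
rewrite invfM mulrAC mulrC ler_pM2l// !rademacherE cellS exprS -mulrA.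
have /andP[] := cell_itv N s.
have i2 : (2 : int)%:~R = 2 :> R by [].
move: (2 ^+ N * s) => x c1 c2.
case: (ltP x) => h1; rewrite ?intrD intrM i2 ?mulr1z;
  case: (ltP (2 * x)) => h2; rewrite le_min; apply/andP; split; lra.
Qed.

(** The inner product is the integral of tent N, because walsh m squares to 1;
    the lower bound of the tent has a computable mean since the two Rademacher
    functions are orthogonal. *)
Lemma dot_hardy_walsh_ge N m : (m < 2 ^ N)%N ->
  (8 * 2 ^+ N)^-1 <= dot (T (W (m + 2 ^ N))) (W m).
Proof.
move=> mN; rewrite dot_hardy_walsh.
have brr := bounded_measurableM (bounded_measurable_rademacher R N)
  (bounded_measurable_rademacher R N.+1).
have b1r := bounded_measurableB (bounded_measurable_cst 1) brr.
have irr := bounded_measurable_integrable brr (measurable_itv `[0, 1[).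
have i1 := bounded_measurable_integrable (bounded_measurable_cst (1 : R))
  (measurable_itv `[0, 1[).
have rr0 : \int[mu]_(s in `[0, 1[) (rademacher N s * rademacher N.+1 s) = 0.
  have [mrr _] := brr; rewrite -(RintegralI_itv mrr).
  have N1 : (0 < 2 ^ N)%N by rewrite expn_gt0.
  have N2 : (2 ^ N < 2 ^ N.+1)%N by rewrite ltn_exp2l.
  rewrite -[RHS](walsh_rademacher_orth R N2 (ltn_trans N1 N2)).
  by apply: eq_Rintegral => s _; rewrite -[(2 ^ N)%N]add0n walshD// !walsh0 mul1r mulr1.
have -> : (8 * 2 ^+ N)^-1 = \int[mu]_(s in `[0, 1[)
    ((8 * 2 ^+ N)^-1 * (1 - rademacher N s * rademacher N.+1 s)).
  rewrite RintegralZl; [|exact: measurable_itv|]; last first.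
    exact: bounded_measurable_integrable b1r (measurable_itv _).
  rewrite RintegralB; [|exact: measurable_itv|exact: i1|exact: irr].
  rewrite rr0.
  by rewrite (@Rintegral_const_itv _ _ 1)//= !subr0 !mulr1.
apply: le_Rintegral.
- exact: measurable_itv.
- apply: bounded_measurable_integrable; last exact: measurable_itv.
  exact: bounded_measurableM (bounded_measurable_cst _) b1r.
- by apply: hardy_walsh_integrable; exact: measurable_itv.
move=> s /=; rewrite in_itv/= => s01.
by rewrite hardy_walshD// mulrAC walsh_sqr mul1r tent_ge.
Qed.

Lemma dot_hardy_walsh0_ge0 : 0 <= dot (T (W 0)) (W 0).
Proof.
rewrite dot_hardy_walsh; apply: Rintegral_ge0 => s _; rewrite walsh0 mulr1.
by rewrite hardy_walsh; apply: Rintegral_ge0 => t _; rewrite walsh0.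
Qed.

(** Removes the top binary digit of n, sending m + 2 ^ j to m for m < 2 ^ j
    (and 0 to 0). *)
Definition clear_top n : nat := n - 2 ^ trunc_log 2 n.

Lemma clear_topD j m : (m < 2 ^ j)%N -> clear_top (m + 2 ^ j) = m.
Proof.
move=> mj; rewrite /clear_top (@trunc_log_eq _ j) ?addnK// leq_addl/=.
by rewrite expnS mul2n -addnn ltn_add2r.
Qed.

Lemma sum_pow2_levels (V : nmodType) (F : nat -> V) J :
  \sum_(n < 2 ^ J) F n =
  F 0%N + \sum_(j < J) \sum_(m < 2 ^ j) F (m + 2 ^ j)%N.
Proof.
elim: J => [|J IH]; first by rewrite big_ord1 big_ord0 addr0.
by rewrite sum_pow2S IH big_ord_recr/= addrA.
Qed.

Lemma sum_dot_hardy_walsh_ge J :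
  J%:R / 8 <= \sum_(n < 2 ^ J) dot (T (W n)) (W (clear_top n)).
Proof.
rewrite (sum_pow2_levels (fun n => dot (T (W n)) (W (clear_top n)))).
rewrite -[leLHS]add0r lerD ?dot_hardy_walsh0_ge0//.
have -> : J%:R / 8 = \sum_(j < J) 8^-1 :> R.
  by rewrite sumr_const card_ord -[RHS]mulr_natl.
apply: ler_sum => j _.
have -> : 8^-1 = \sum_(m < 2 ^ j) (8 * 2 ^+ j)^-1 :> R.
  rewrite sumr_const card_ord -[RHS]mulr_natl natrX invfM mulrCA divff ?mulr1//.
apply: ler_sum => m _; rewrite clear_topD//; exact: dot_hardy_walsh_ge.
Qed.

(** By linearity the sum is phi(v) with v = sum_n c_n w_n, c_n being the
    coefficient of y at clear_top n. By Pythagoras |v|^2 is the sum of the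
    c_n^2; Bessel's inequality for y bounds the part of n = 0 and that of each
    of the J levels by |y|^2. *)
Lemma rank_one_trace_le (phi : {linear L2 -> R^o}) (y : L2) J : bounded_op phi ->
  \sum_(n < 2 ^ J) phi (W n) * dot y (W (clear_top n)) <=
  Num.sqrt J.+1%:R * (fine (opnorm phi) * `|y|).
Proof.
move=> bphi; pose c n := dot y (W (clear_top n)).
have -> : \sum_(n < 2 ^ J) phi (W n) * dot y (W (clear_top n)) =
    phi (\sum_(n < 2 ^ J) c n *: W n).
  by rewrite linear_sum; apply: eq_bigr => n _; rewrite linearZ mulrC.
apply: le_trans (ler_norm _) _; apply: le_trans (opnorm_le bphi _) _.
have op0 : 0 <= fine (opnorm phi) by rewrite fine_ge0 ?opnorm_ge0.
rewrite mulrCA ler_wpM2l// -[leLHS]ger0_norm// -sqrtr_sqr.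
rewrite -[`|y|]ger0_norm// -sqrtr_sqr -sqrtrM// ler_wsqrtr//.
rewrite (pythagoras (@walshL2_orth R)) (sum_pow2_levels (fun n => c n ^+ 2)).
have cy0 : c 0%N ^+ 2 <= `|y| ^+ 2.
  have := bessel (@walshL2_orth R) 1 y; rewrite big_ord1; exact: le_trans.
rewrite mulr_natl mulrS lerD//.
have -> : `|y| ^+ 2 *+ J = \sum_(j < J) `|y| ^+ 2 by rewrite sumr_const card_ord.
apply: ler_sum => j _; apply: le_trans (bessel (@walshL2_orth R) (2 ^ j) y).
by apply: ler_sum => m _; rewrite /c clear_topD.
Qed.

Lemma hardy_not_nuclear : ~ nuclear T.
Proof.
move=> [phi [y [bphi sumphi Tphi]]].
pose u i := fine (opnorm (phi i)) * `|y i|.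
have uE i : (u i)%:E = (opnorm (phi i) * `|y i|%:E)%E.
  by rewrite EFinM fineK// opnorm_fin_num.
have [nu Hnu] : exists nu : R, forall I, \sum_(i < I) u i <= nu.
  exists (fine (\sum_(i <oo) (opnorm (phi i) * `|y i|%:E))%E) => I.
  have u0 i : (0 <= opnorm (phi i) * `|y i|%:E)%E.
    by rewrite mule_ge0 ?opnorm_ge0 ?lee_fin.
  rewrite -lee_fin fineK; last by rewrite ge0_fin_numE// nneseries_ge0.
  rewrite -sumEFin -(big_mkord xpredT (fun i => (u i)%:E)).
  under eq_bigr do rewrite uE.
  exact: nneseries_lim_ge.
have nu0 : 0 <= nu by have := Hnu 0%N; rewrite big_ord0.
have main J : J%:R / 8 <= Num.sqrt J.+1%:R * nu.
  apply: le_trans (sum_dot_hardy_walsh_ge J) _.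
  have cv : (fun I => \sum_(n < 2 ^ J)
      dot (series (fun i => (phi i (W n) : R) *: y i) I) (W (clear_top n))) @ \oo -->
      \sum_(n < 2 ^ J) dot (T (W n)) (W (clear_top n)).
    apply: cvg_big => [|n _]; first exact: add_continuous.
    apply/cvgrPdist_le => e e0.
    have /cvgrPdist_le/(_ e e0) := Tphi (W n).
    apply: filterS => I; apply: le_trans.
    rewrite -[_ - dot _ _](_ : dot (T (W n) - series (fun i => (phi i (W n) : R) *: y i) I)
       (W (clear_top n)) = _).
      by rewrite (le_trans (dot_cauchy_schwarz _ _))// norm_walshL2 mulr1.
    by rewrite dotC dotBr !(dotC (W _)).
  apply: (ler_cvg_to cv (cvg_cst _)); apply: nearW => I.
  have -> : \sum_(n < 2 ^ J)
      dot (series (fun i => (phi i (W n) : R) *: y i) I) (W (clear_top n)) =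
      \sum_(i < I) \sum_(n < 2 ^ J) phi i (W n) * dot (y i) (W (clear_top n)).
    rewrite exchange_big/=; apply: eq_bigr => n _.
    rewrite /series/= big_mkord dot_suml; apply: eq_bigr => i _.
    by rewrite dotZl.
  apply: (@le_trans _ _ (\sum_(i < I) Num.sqrt J.+1%:R * u i)).
    by apply: ler_sum => i _; exact: rank_one_trace_le.
  by rewrite -mulr_sumr ler_wpM2l ?sqrtr_ge0.
(* J / 8 <= nu sqrt(J + 1) fails once J exceeds 128 nu^2 + 1. *)
have nu2 : 0 <= 128 * nu ^+ 2 by rewrite mulr_ge0// sqr_ge0.
have [J xJ] : exists J : nat, 128 * nu ^+ 2 + 1 < J%:R.
  by exists (Num.bound (128 * nu ^+ 2 + 1)); rewrite archi_boundP// addr_ge0.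
have := main J; rewrite leNgt => /negP; apply.
have J1 : 1 <= J%:R :> R by lra.
rewrite -(@ltr_sqr _ (Num.sqrt _ * _)) ?nnegrE ?mulr_ge0 ?sqrtr_ge0//.
rewrite exprMn sqr_sqrtr// expr_div_n -natr1.
have : 128 * nu ^+ 2 * J%:R < J%:R * J%:R by rewrite ltr_pM2r; lra.
have : nu ^+ 2 <= nu ^+ 2 * J%:R by rewrite ler_peMr// sqr_ge0.
by rewrite [J%:R ^+ 2]expr2; lra.
Qed.

End nuclear_trace.

Theorem mainTheorem5 (R : realType) :
  (forall (p : R) (p1 : 1 < p) (q : \bar R), (1 < q)%E ->
     q_compact q (hardy p1 : {linear LI (lt1r2 R) -> LI p1})) /\
  (forall q : \bar R, (1 < q)%E ->
     q_compact q (hardy (lt1r2 R) : {linear LI (lt1r2 R) -> LI (lt1r2 R)})) /\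
  ~ nuclear (hardy (lt1r2 R) : {linear LI (lt1r2 R) -> LI (lt1r2 R)}).
Proof.
split; first by move=> p p1 q; exact: q_compact_hardy.
by split; [move=> q; exact: q_compact_hardy|exact: hardy_not_nuclear].
Qed.
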